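(* Let $F_1,F_2:\mathbb R\to(0,\infty)$ be measurable and $\psi\in\mathcal C$ with $I(F_1\circ\psi,\psi),I(F_2\circ\psi^*,\psi^* )\in(0,\infty)$. Let $h,h_1$ be functions such that $h_1$ has an inverse $h_1^{-1}$, and put $H=h\circ h_1^{-1}$. (i) Assume one of: (a) $h\in\Phi$, $h_1\in\Psi$ and $H$ increasing; (b) $h,h_1\in\Phi$ and $H$ decreasing; (c) $H$ concave and increasing, and either $h,h_1\in\Phi$ or $h,h_1\in\Psi$. Then $$\frac{as^{orlicz}_{h,F_1,F_2}(\psi)}{I(F_1\circ\psi,\psi)}\le H\Big(\frac{as^{orlicz}_{h_1,F_1,F_2}(\psi)}{I(F_1\circ\psi,\psi)}\Big).$$ (ii) Assume one of: (d) $h\in\Psi$, $h_1\in\Phi$ and $H$ increasing; (e) $H$ convex and decreasing, with one of $h,h_1$ in $\Phi$ and the other in $\Psi$; (f) $H$ convex and increasing, and either $h,h_1\in\Phi$ or $h,h_1\in\Psi$. Then $$\frac{as^{orlicz}_{h,F_1,F_2}(\psi)}{I(F_1\circ\psi,\psi)}\ge H\Big(\frac{as^{orlicz}_{h_1,F_1,F_2}(\psi)}{I(F_1\circ\psi,\psi)}\Big).$$ The same inequalities hold with $as^{orlicz}$ replaced by $G^{orlicz}$ throughout, provided in addition $F_2\circ\psi^*\in\mathcal L_{\psi^*}$ in cases (a), (b) and (d).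
   Context: $\mathcal C$ is the set of convex $\psi:\mathbb R^n\to\mathbb R\cup\{+\infty\}$ with domain of nonempty interior; $\psi^*(y)=\sup_x(\langle x,y\rangle-\psi(x))$; $\nabla^2\psi$ is the Alexandrov Hessian; $X_\psi=\{x:\psi(x)<\infty,\ \nabla^2\psi(x)\text{ exists and is invertible}\}$. $I(F\circ\psi,\psi)=\int_{X_\psi}F(\psi(x))dx$, $I(g,\psi^* )=\int_{X_{\psi^*}}g$; $\mathcal F^+_{\psi^*}$: integrable $g>0$ on $X_{\psi^*}$ with $0<I(g,\psi^* )<\infty$; $\mathcal L_{\psi^*}$: its log-concave members. For continuous $h:(0,\infty)\to(0,\infty)$, $V_{h,F_1,F_2}(\psi,g)=\int_{X_\psi}h\big(\frac{g(\nabla\psi(x))}{F_2(\langle x,\nabla\psi(x)\rangle-\psi(x))}\big)F_1(\psi(x))dx$. $\Phi$: $h$ constant or strictly convex; $\Psi$: $h$ constant or increasing strictly concave. For $h\in\Phi$, $as^{orlicz}_{h,F_1,F_2}(\psi)=\inf_{g\in\mathcal F^+_{\psi^*}}V_{h,F_1,F_2}(\psi,(\sqrt{2\pi})^ng/I(g,\psi^* ))$ and $G^{orlicz}_{h,F_1,F_2}(\psi)$ is the same infimum over $\mathcal L_{\psi^*}$; for $h\in\Psi$ replace $\inf$ by $\sup$. Standing assumption: all integrals are well defined. *)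

(* Defs.v *)
From HB Require Import structures.
From mathcomp Require Import all_boot all_order all_algebra.
From mathcomp Require Import all_classical all_reals all_analysis.
Set Implicit Arguments. Unset Strict Implicit. Unset Printing Implicit Defensive.
Import Order.TTheory GRing.Theory Num.Theory.
Import numFieldNormedType.Exports.
Local Open Scope classical_set_scope.
Local Open Scope ring_scope.

Section Defs.
Variables (R : realType).

Definition dotv (n : nat) (x y : 'rV[R]_n) : R := \sum_(i < n) x ord0 i * y ord0 i.

(* Integral over R^n w.r.t. Lebesgue measure, for nonnegative integrands,
   computed as an iterated one-dimensional Lebesgue integral (Tonelli). *)
Fixpoint iint (n : nat) : ('rV[R]_n -> \bar R) -> \bar R :=
  match n return ('rV[R]_n -> \bar R) -> \bar R with
  | 0 => fun f => f 0
  | m.+1 => fun f =>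
      (\int[@lebesgue_measure R]_x
         iint (fun v : 'rV[R]_m => f (row_mx (const_mx x : 'rV[R]_1) v)))%E
  end.

Definition lint (n : nat) (X : set 'rV[R]_n) (f : 'rV[R]_n -> \bar R) : \bar R :=
  iint (fun x => if `[< X x >] then f x else 0%E).

Definition borelRn (n : nat) : set (set 'rV[R]_n) :=
  smallest (sigma_algebra setT) (@open 'rV[R]_n).

Definition leb_null (n : nat) (N : set 'rV[R]_n) : Prop :=
  exists B, borelRn B /\ N `<=` B /\
    iint (fun x => if `[< B x >] then 1%E else 0%E) = 0%E.

Definition leb_measurable_fun (n : nat) (g : 'rV[R]_n -> R) : Prop :=
  exists g' : 'rV[R]_n -> R,
    (forall B : set R, measurable B -> borelRn (g' @^-1` B)) /\
    leb_null [set x | g x <> g' x].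

Definition in_C (n : nat) (psi : 'rV[R]_n -> \bar R) : Prop :=
  [/\ (forall x, psi x != -oo%E),
      (forall (x y : 'rV[R]_n) (t : R), 0 < t < 1 ->
          (psi ((1 - t) *: x + t *: y)%R <= (1 - t)%:E * psi x + t%:E * psi y)%E) &
      (exists (x0 : 'rV[R]_n) (r : R), 0 < r /\
          forall y : 'rV[R]_n, (forall i, `|y ord0 i - x0 ord0 i| < r) -> (psi y < +oo)%E)].

Definition legendre (n : nat) (psi : 'rV[R]_n -> \bar R) : 'rV[R]_n -> \bar R :=
  fun y => ereal_sup (range (fun x => ((dotv x y)%:E - psi x)%E)).

(* psi has gradient p and (symmetric) Alexandrov Hessian A at x *)
Definition alex (n : nat) (psi : 'rV[R]_n -> \bar R) (x p : 'rV[R]_n)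
    (A : 'M[R]_n) : Prop :=
  A^T = A /\ psi x \is a fin_num /\
  forall eps : R, 0 < eps -> exists delta : R, 0 < delta /\
    forall y, dotv (y - x) (y - x) < delta ->
      psi y \is a fin_num /\
      `| fine (psi y) - fine (psi x) - dotv p (y - x)
         - 2^-1 * dotv ((y - x) *m A) (y - x) | <= eps * dotv (y - x) (y - x).

Definition Xset (n : nat) (psi : 'rV[R]_n -> \bar R) : set 'rV[R]_n :=
  [set x | (psi x < +oo)%E /\ exists p A, alex psi x p A /\ A \in unitmx].

(* the gradient (unique where the Alexandrov Hessian exists) *)
Definition grad (n : nat) (psi : 'rV[R]_n -> \bar R) (x : 'rV[R]_n) : 'rV[R]_n :=
  xget 0 [set p | exists A, alex psi x p A].

Definition IF (n : nat) (psi : 'rV[R]_n -> \bar R) (F : R -> R) : \bar R :=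
  lint (Xset psi) (fun x => (F (fine (psi x)))%:E).

Definition Ig (n : nat) (psi : 'rV[R]_n -> \bar R) (g : 'rV[R]_n -> R) : \bar R :=
  lint (Xset psi) (fun y => (g y)%:E).

Definition Fplus (n : nat) (psis : 'rV[R]_n -> \bar R) : set ('rV[R]_n -> R) :=
  [set g | [/\ leb_measurable_fun g, (forall y, Xset psis y -> 0 < g y) &
            (0 < Ig psis g < +oo)%E]].

Definition log_concave (n : nat) (g : 'rV[R]_n -> R) : Prop :=
  (forall x, 0 <= g x) /\
  forall x y (t : R), 0 < t < 1 ->
    g x `^ (1 - t) * g y `^ t <= g ((1 - t) *: x + t *: y).

Definition Lset (n : nat) (psis : 'rV[R]_n -> \bar R) : set ('rV[R]_n -> R) :=
  [set g | Fplus psis g /\ log_concave g].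

Definition Vorl (n : nat) (h F1 F2 : R -> R) (psi : 'rV[R]_n -> \bar R)
    (g : 'rV[R]_n -> R) : \bar R :=
  lint (Xset psi) (fun x =>
    (h (g (grad psi x) / F2 (dotv x (grad psi x) - fine (psi x)))
       * F1 (fine (psi x)))%:E).

Definition normalize (n : nat) (psi : 'rV[R]_n -> \bar R) (g : 'rV[R]_n -> R) :
    'rV[R]_n -> R :=
  fun y => Num.sqrt (2 * pi) ^+ n * g y / fine (Ig (legendre psi) g).

Definition pos_cont (h : R -> R) : Prop :=
  (forall t, 0 < t -> 0 < h t) /\ {within [set t : R | 0 < t], continuous h}.

Definition const_pos (h : R -> R) : Prop :=
  forall s t, 0 < s -> 0 < t -> h s = h t.

Definition strict_convex_pos (h : R -> R) : Prop :=
  forall x y t, 0 < x -> 0 < y -> x != y -> 0 < t < 1 ->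
    h ((1 - t) * x + t * y) < (1 - t) * h x + t * h y.

Definition strict_concave_pos (h : R -> R) : Prop :=
  forall x y t, 0 < x -> 0 < y -> x != y -> 0 < t < 1 ->
    (1 - t) * h x + t * h y < h ((1 - t) * x + t * y).

Definition incr_pos (h : R -> R) : Prop :=
  forall x y, 0 < x -> x < y -> h x < h y.

Definition inPhi (h : R -> R) : Prop :=
  pos_cont h /\ (const_pos h \/ strict_convex_pos h).

Definition inPsi (h : R -> R) : Prop :=
  pos_cont h /\ (const_pos h \/ (incr_pos h /\ strict_concave_pos h)).

Definition as_orlicz (n : nat) (h F1 F2 : R -> R) (psi : 'rV[R]_n -> \bar R) : \bar R :=
  let S := [set Vorl h F1 F2 psi (normalize psi g) | g in Fplus (legendre psi)] in
  if `[< inPhi h >] then ereal_inf S else ereal_sup S.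

Definition G_orlicz (n : nat) (h F1 F2 : R -> R) (psi : 'rV[R]_n -> \bar R) : \bar R :=
  let S := [set Vorl h F1 F2 psi (normalize psi g) | g in Lset (legendre psi)] in
  if `[< inPhi h >] then ereal_inf S else ereal_sup S.

Definition F2_comp (n : nat) (F2 : R -> R) (psis : 'rV[R]_n -> \bar R) : 'rV[R]_n -> R :=
  fun y => if psis y \is a fin_num then F2 (fine (psis y)) else 0.

Definition incr_on (J : set R) (H : R -> R) : Prop :=
  forall x y, J x -> J y -> x < y -> H x < H y.
Definition decr_on (J : set R) (H : R -> R) : Prop :=
  forall x y, J x -> J y -> x < y -> H y < H x.
Definition concave_on (J : set R) (H : R -> R) : Prop :=
  forall x y t, J x -> J y -> 0 <= t <= 1 ->
    (1 - t) * H x + t * H y <= H ((1 - t) * x + t * y).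
Definition convex_on (J : set R) (H : R -> R) : Prop :=
  forall x y t, J x -> J y -> 0 <= t <= 1 ->
    H ((1 - t) * x + t * y) <= (1 - t) * H x + t * H y.

(* the conclusion: Q(h)/I <= H(Q(h1)/I) (le = true) or >= (le = false),
   where Q is as^{orlicz} or G^{orlicz}; the argument of H is required to be
   in the domain J of H = h o h1^{-1} *)
Definition orlicz_ineq (le : bool) (Q : (R -> R) -> \bar R) (I : R)
    (J : set R) (h h1 H : R -> R) : Prop :=
  Q h1 \is a fin_num -> J (fine (Q h1) / I) ->
  if le then (Q h * (I^-1)%:E <= (H (fine (Q h1) / I))%:E)%E
  else ((H (fine (Q h1) / I))%:E <= Q h * (I^-1)%:E)%E.

End Defs.

(* Main.v *)
Require Import Defs.
From HB Require Import structures.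
From mathcomp Require Import all_boot all_order all_algebra.
From mathcomp Require Import all_classical all_reals all_analysis.
From mathcomp Require Import archimedean measurable_realfun ring lra.
Import Order.TTheory GRing.Theory Num.Theory.
Import numFieldNormedType.Exports.
Set Implicit Arguments. Unset Strict Implicit. Unset Printing Implicit Defensive.
Local Open Scope classical_set_scope.
Local Open Scope ring_scope.

(** Write u_g(x) = g(grad psi x) / F2(psi^*(grad psi x)) for the normalised g.
    In cases (a), (b), (d) one tests with g = F2 o psi^*, for which u_g is a
    constant c, so that V_h(psi, g) = h(c) I and V_h1(psi, g) = h1(c) I.  In the
    other cases one integrates against F1(psi) dx the supporting line of H at
    s0 = as_h1 / I, evaluated at h1(u_g), and passes to the infimum or supremum
    over g.

    The integrals are iterated lower integrals, which are additive only when
    one summand is measurable.  In (c) and (f) that summand is a multiple of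
    F1(psi) on X_psi, which is Borel because the gradient and the Hessian are
    limits of difference quotients.  In (e) both summands involve u_g, whose
    measurability could fail since g is only Lebesgue measurable.  The one of
    h, h1 that lies in Phi is decreasing there, and g can be replaced by a Borel
    function at no cost: by a large multiple of F2 o psi^* on the exceptional
    null set for as, and by its upper semicontinuous envelope for G.  The
    envelope of a log-concave g is log-concave, and differs from g only on the
    boundaries of countably many convex sets, which are null.

    That u_g > 0 on X_psi uses that grad psi maps X_psi into X_{psi^*}, the
    Hessian of psi^* at grad psi x being the inverse of that of psi at x. *)

(** * Lower integrals and the Borel structure of R^n *)

(** Changing g on a null set does not obviously preserve V: g enters through grad psi, and that grad
    psi pulls null sets back to null sets would call for a change of variables formula. Both
    replacements of g are therefore built to give an inequality at every point of X_psi. On the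
    exceptional set g is given values at which the function in Phi is within epsilon of its infimum,
    and the envelope lies above g, which lowers a decreasing function. Null sets matter only on the
    dual side, where they keep the normalising integral of g unchanged.

    A supporting line at s0 exists because s0 is never an end point of the range of h1: a continuous
    injective function on (0, oo) is strictly monotone, so each of its values is passed on both
    sides.

    Constants lie in both Phi and Psi, where the functional would be an infimum or a supremum. They
    are excluded by the injectivity of h1 and the strict monotonicity of H. *)

Section lower_integral.
Local Open Scope ereal_scope.
Context (d : measure_display) (T : measurableType d) (R : realType).
Variable mu : {measure set T -> \bar R}.
Import HBNNSimple.

Lemma ge0_le_integral_nomeas (f g : T -> \bar R) :
  (forall x, 0 <= f x) -> (forall x, f x <= g x) ->
  \int[mu]_x f x <= \int[mu]_x g x.
Proof.
move=> f0 fg; have g0 x : 0 <= g x by apply: le_trans (fg x).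
rewrite !ge0_integralTE//; apply: ereal_sup_le => _ [s /= sf <-].
by exists s => //= x; apply: le_trans (fg x).
Qed.

Lemma integral_le_nnsfun (g : T -> \bar R) (M : \bar R) : (forall x, 0 <= g x) ->
  (forall s : {nnsfun T >-> R}, (forall x, (s x)%:E <= g x) ->
     \int[mu]_x (s x)%:E <= M) -> \int[mu]_x g x <= M.
Proof.
move=> g0 H; rewrite ge0_integralTE//; apply: ge_ereal_sup => _ [s /= sg <-].
by have := H s sg; rewrite integral_nnsfun// patch_setT.
Qed.

Lemma ge0_integralZl_nomeas (g : T -> \bar R) (c : R) : (0 <= c)%R ->
  (forall x, 0 <= g x) -> \int[mu]_x (c%:E * g x) = c%:E * \int[mu]_x g x.
Proof.
(* Used for [c] and for [c^-1], this one inequality gives both directions. *)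
have H (k : R) (g' : T -> \bar R) : (0 < k)%R -> (forall x, 0 <= g' x) ->
    k%:E * \int[mu]_x g' x <= \int[mu]_x (k%:E * g' x).
  move=> k0 g0; rewrite -lee_pdivlMl//; apply: integral_le_nnsfun => // s sg.
  rewrite lee_pdivlMl// -ge0_integralZl//=; last 3 first.
  - exact/measurable_EFinP.
  - by move=> x _; rewrite lee_fin.
  - by rewrite lee_fin ltW.
  apply: ge0_le_integral_nomeas => x; first by rewrite mule_ge0 ?lee_fin// ltW.
  by rewrite lee_pmul2l.
rewrite le_eqVlt => /predU1P[<- g0|c0 g0].
  by rewrite mul0e integral0_eq// => x _; rewrite mul0e.
apply/eqP; rewrite eq_le H// andbT.
have cg0 x : 0 <= c%:E * g x by rewrite mule_ge0 ?lee_fin// ltW.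
have ci : (0 < c^-1)%R by rewrite invr_gt0.
have := H _ _ ci cg0.
rewrite (_ : (fun x => c^-1%:E * (c%:E * g x)) = g); last first.
  by apply/funext => x; rewrite muleA -EFinM mulVf ?gt_eqF// mul1e.
by rewrite lee_pdivrMl.
Qed.

(** A simple [s] below [f + g] splits, up to an upper bound, into the minimum of [f] and [s] and the
    positive part of [s - f]. Both are measurable because [f] and [s] are, and the second is at most
    [g], whatever [g] is. The converse only adds to [f] simple functions below [g]. *)
Lemma ge0_integralD_nomeas (f g : T -> \bar R) : measurable_fun setT f ->
  (forall x, 0 <= f x) -> (forall x, 0 <= g x) ->
  \int[mu]_x (f x + g x) = \int[mu]_x f x + \int[mu]_x g x.
Proof.
move=> mf f0 g0; have fg0 x : 0 <= f x + g x by rewrite adde_ge0.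
apply/eqP; rewrite eq_le; apply/andP; split.
  apply: integral_le_nnsfun => // s sfg.
  have ms : measurable_fun setT (fun x => (s x)%:E) by exact/measurable_EFinP.
  have mm : measurable_fun setT (fun x => mine (f x) (s x)%:E) by exact: measurable_mine.
  have mp : measurable_fun setT (fun x => maxe ((s x)%:E - f x) 0).
    by apply: measurable_maxe => //; exact: emeasurable_funB.
  have s0 x : 0 <= (s x)%:E by rewrite lee_fin.
  apply: (@le_trans _ _ (\int[mu]_x (mine (f x) (s x)%:E + maxe ((s x)%:E - f x) 0))).
    apply: ge0_le_integral_nomeas => // x; rewrite /mine; case: ltP => [fs|sf].
      have ff : f x \is a fin_num.
        by rewrite ge0_fin_numE// (lt_trans fs)// ltry.
      rewrite maxEle; case: ifPn => [|_]; last by rewrite addeC subeK.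
      by rewrite sube_le0 leNgt fs.
    by rewrite leeDl// le_max lexx orbT.
  rewrite ge0_integralD//; last 2 first.
  - by move=> x _; rewrite le_min f0 s0.
  - by move=> x _; rewrite le_max lexx orbT.
  apply: leeD; apply: ge0_le_integral_nomeas => x.
  - by rewrite le_min f0 s0.
  - by rewrite ge_min lexx.
  - by rewrite le_max lexx orbT.
  - rewrite ge_max g0 andbT; have [ff|] := boolP (f x \is a fin_num).
      by rewrite leeBlDl.
    by rewrite ge0_fin_numE// -leNgt leye_eq => /eqP ->; rewrite addeNy leNye.
have if0 : 0 <= \int[mu]_x f x by exact: integral_ge0.
have [foo|] := boolP (\int[mu]_x f x \is a fin_num).
  rewrite -leeBrDl//; apply: integral_le_nnsfun => // s sg.
  rewrite leeBrDl// -ge0_integralD//; last 2 first.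
  - by move=> x _; rewrite lee_fin.
  - exact/measurable_EFinP.
  by apply: ge0_le_integral_nomeas => x; [rewrite adde_ge0 ?lee_fin|exact: leeD].
rewrite ge0_fin_numE// -leNgt leye_eq => /eqP foo.
suff -> : \int[mu]_x (f x + g x) = +oo by rewrite leey.
apply/eqP; rewrite -leye_eq -foo; apply: ge0_le_integral_nomeas => // x.
by rewrite leeDl.
Qed.

End lower_integral.

Lemma measurable_exists (d : measure_display) (T : measurableType d)
  (I : countType) (P : I -> set T) : (forall i, measurable (P i)) ->
  measurable [set t | exists i, P i t].
Proof.
move=> mP; have -> : [set t | exists i, P i t] = \bigcup_i P i.
  by apply/seteqP; split=> t [i]; exists i.
exact: countable_bigcupT_measurable.
Qed.

Lemma measurable_forall (d : measure_display) (T : measurableType d)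
  (I : countType) (P : I -> set T) : (forall i, measurable (P i)) ->
  measurable [set t | forall i, P i t].
Proof.
move=> mP; have -> : [set t | forall i, P i t] = ~` [set t | exists i, (~` P i) t].
  apply/seteqP; split=> t /= Pt; first by case=> i; apply.
  by move=> i; apply: contrapT => Pit; apply: Pt; exists i.
by apply/measurableC/measurable_exists => i; exact: measurableC.
Qed.

Section borel_space.
Variable R : realType.

(** The sigma-algebra is that of [borelRn], carried by a type so that [measurable_fun] applies to
    maps on R^n. *)
Definition borel_rV (n : nat) := g_sigma_algebraType (@open 'rV[R]_n).
HB.instance Definition _ n := Measurable.on (borel_rV n).

Lemma openP_rV (n : nat) (O : set 'rV[R]_n) : open O <->
  forall x, O x -> exists2 e : R, 0 < e &
    forall y : 'rV[R]_n, (forall i, `|y ord0 i - x ord0 i| < e) -> O y.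
Proof.
rewrite openE; split=> H x Ox.
  have /nbhs_ballP[e /= e0 xe] := H x Ox.
  exists e => // y ye; apply: xe; split=> // i j; rewrite /ball/= (ord1 i) distrC; exact: ye.
have [e e0 xe] := H x Ox; apply/nbhs_ballP; exists e => //= y [_ xy].
by apply: xe => i; have := xy ord0 i; rewrite /ball/= distrC.
Qed.

Lemma measurable_coord (n : nat) (i : 'I_n) :
  measurable_fun setT (fun x : borel_rV n => (x : 'rV[R]_n) ord0 i).
Proof.
apply: (measurability _ (RGenOpens.measurableE R)) => _ [_ [a [b ->] <-]].
rewrite setTI; apply: sub_sigma_algebra.
apply/openP_rV => x /= xab; have /nbhs_ballP[e /= e0 xe] :=
  open_nbhs_nbhs (conj (@interval_open _ (BRight a) (BLeft b) isT isT) xab).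
exists e => // y ye; apply: xe; rewrite /ball/= distrC; exact: ye.
Qed.

(** An open set is a countable union of cubes with rational centre and radius 1/(k+1), and the
    preimage of a cube is cut out by conditions on single coordinates. *)
Lemma measurable_rV (d : measure_display) (T : measurableType d) (n : nat)
  (f : T -> borel_rV n) :
  (forall i, measurable_fun setT (fun t => (f t : 'rV[R]_n) ord0 i)) ->
  measurable_fun setT f.
Proof.
move=> mf; apply: (@measurability _ _ _ (borel_rV n) _ _ (@open 'rV[R]_n)) => //.
move=> _ [U oU <-]; rewrite setTI.
pose B (p : 'rV[rat]_n * nat) : set 'rV[R]_n :=
  [set y | forall i, `|y ord0 i - ratr (p.1 ord0 i)| < p.2.+1%:R^-1].
have -> : f @^-1` U = \bigcup_(p in [set p | B p `<=` U]) (f @^-1` B p).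
  apply/seteqP; split=> [t /= Uft|t [p /= pU] Bt]; last exact: pU.
  move/openP_rV : oU => /(_ _ Uft)[e e0 eU].
  pose k := Num.truncn (2 / e).
  have ke : k.+1%:R^-1 < e / 2 :> R.
    have : 2 / e < k.+1%:R by exact: truncnS_gt.
    rewrite ltr_pdivrMr// => ?; rewrite ltr_pdivlMr// mulrC.
    by rewrite ltr_pdivrMr// mulrC.
  have k0 : 0 < k.+1%:R^-1 :> R by rewrite invr_gt0.
  have /choice[q qP] : forall i, exists q : rat,
      `|(f t : 'rV[R]_n) ord0 i - ratr q| < k.+1%:R^-1.
    move=> i; have [] := @rat_in_itvoo R ((f t : 'rV[R]_n) ord0 i)
      ((f t : 'rV[R]_n) ord0 i + k.+1%:R^-1); first by rewrite ltrDl.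
    by move=> q; rewrite in_itv/= => /andP[h1 h2]; exists q; rewrite ltr_distlC; rewrite h2 andbT (lt_trans _ h1)// gtrBl.
  exists (\row_i q i, k) => /=; last by move=> i /=; rewrite mxE.
  move=> y /= yB; apply: eU => i.
  have := yB i; rewrite mxE => h1; have h2 := qP i; rewrite distrC in h2.
  rewrite -(subrK (ratr (q i)) (y ord0 i)) -addrA.
  apply: (le_lt_trans (ler_normD _ _)); rewrite (splitr e).
  by apply: ltrD; apply: lt_trans ke.
rewrite bigcup_mkcond; apply: countable_bigcupT_measurable => // p.
case: ifP => // _; apply: measurable_forall => i.
have mi : measurable_fun setT
    (fun t => `|(f t : 'rV[R]_n) ord0 i - ratr (p.1 ord0 i)|).
  by apply: measurableT_comp => //; apply: measurable_funB => //.
have := mi measurableT _ (measurable_itv `]-oo, p.2.+1%:R^-1[); rewrite setTI.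
by congr measurable; apply/seteqP; split=> t /=; rewrite in_itv.
Qed.
End borel_space.

Section product_sigma_finite.
Context (d1 d2 : measure_display) (T1 : measurableType d1)
  (T2 : measurableType d2) (R : realType).
Variables (m1 : {sigma_finite_measure set T1 -> \bar R})
  (m2 : {sigma_finite_measure set T2 -> \bar R}).

Lemma sigma_finite_product_measure1 : sigma_finite setT (m1 \x m2)%E.
Proof.
have [F FT Ffin] := sigma_finiteT m1; have [G GT Gfin] := sigma_finiteT m2.
(* The rectangles are enumerated through a coding of pairs; a number that codes no pair gets the
   empty set. *)
pose D (k : nat) := if unpickle k is Some p then F p.1 `*` G p.2 else set0.
exists D => [|k].
  apply/seteqP; split=> // -[x y] _.
  have [i _ Fx] : (\bigcup_i F i) x by rewrite -FT.
  have [j _ Gy] : (\bigcup_j G j) y by rewrite -GT.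
  by exists (pickle (i, j)) => //; rewrite /D pickleK.
rewrite /D; case: unpickle => [[i j]|]; last by rewrite measure0.
have [mF Foo] := Ffin i; have [mG Goo] := Gfin j.
split; first exact: measurableX.
rewrite [ltLHS]product_measure1E//.
by rewrite lte_mul_pinfty// ge0_fin_numE.
Qed.

(** A separate name carries the sigma-finite structure, so that a product can serve as a factor
    again when one more coordinate is added. *)
Definition product_sigma_finite : set (T1 * T2) -> \bar R := (m1 \x m2)%E.
HB.instance Definition _ := Measure.on product_sigma_finite.
HB.instance Definition _ := Measure_isSigmaFinite.Build _ _ _
  product_sigma_finite sigma_finite_product_measure1.

End product_sigma_finite.

(** * Iterated integrals over R^n *)

Section iint.
Variable R : realType.
Local Open Scope ereal_scope.

Definition cons_rV (n : nat) (x : R) (v : 'rV[R]_n) : 'rV[R]_n.+1 :=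
  row_mx (const_mx x : 'rV[R]_1) v.

Lemma cons_rV0 n x (v : 'rV[R]_n) : cons_rV x v ord0 ord0 = x.
Proof.
have e : ord0 = lshift n (ord0 : 'I_1) by exact/val_inj.
rewrite /cons_rV [LHS](congr1 (row_mx (const_mx x : 'rV[R]_1) v ord0) e).
by rewrite [LHS]row_mxEl mxE.
Qed.

Lemma cons_rVS n x (v : 'rV[R]_n) i : cons_rV x v ord0 (lift ord0 i) = v ord0 i.
Proof.
have e : lift ord0 i = rshift 1 i by exact/val_inj.
rewrite /cons_rV [LHS](congr1 (row_mx (const_mx x : 'rV[R]_1) v ord0) e).
by rewrite [LHS]row_mxEr.
Qed.

Lemma rV_consP n (w : 'rV[R]_n.+1) : exists x v, w = cons_rV x v.
Proof.
exists (w ord0 ord0), (\row_i w ord0 (lift ord0 i)); apply/rowP => i.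
by have [j ->|->] := fintype.unliftP ord0 i; rewrite ?cons_rV0 ?cons_rVS ?mxE.
Qed.

Lemma iint_ge0 n (f : 'rV[R]_n -> \bar R) : (forall x, 0 <= f x) -> 0 <= iint f.
Proof.
elim: n f => [|n IH] f f0 //=; apply: integral_ge0 => x _; exact: IH.
Qed.

Lemma iint_le n (f g : 'rV[R]_n -> \bar R) : (forall x, 0 <= f x) ->
  (forall x, f x <= g x) -> iint f <= iint g.
Proof.
elim: n f g => [|n IH] f g f0 fg //=.
apply: ge0_le_integral_nomeas => x; first exact: iint_ge0.
exact: IH.
Qed.

Lemma iintZ n (f : 'rV[R]_n -> \bar R) (c : R) : (0 <= c)%R ->
  (forall x, 0 <= f x) -> iint (fun x => c%:E * f x) = c%:E * iint f.
Proof.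
move=> c0; elim: n f => [|n IH] f f0 //=.
rewrite -ge0_integralZl_nomeas//; last by move=> x; exact: iint_ge0.
by apply: eq_integral => x _; rewrite IH.
Qed.

Lemma measurable_cons_rV (d : measure_display) (T : measurableType d) n
  (f : T -> measurableTypeR R) (phi : T -> borel_rV R n) :
  measurable_fun setT f -> measurable_fun setT phi ->
  measurable_fun setT (fun t => cons_rV (f t) (phi t) : borel_rV R n.+1).
Proof.
move=> mf mphi; apply: measurable_rV => i.
have [j ->|->] := fintype.unliftP ord0 i; last first.
  by under eq_fun do rewrite cons_rV0.
under eq_fun do rewrite cons_rVS.
exact: (measurableT_comp (@measurable_coord R n j) mphi).
Qed.

Lemma measurable_slice n (f : borel_rV R n.+1 -> \bar R) x : measurable_fun setT f ->
  measurable_fun setT (fun v : borel_rV R n => f (cons_rV x v)).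
Proof.
by move=> mf; apply: (measurableT_comp mf); exact: measurable_cons_rV.
Qed.

(** On nonnegative Borel functions the iterated integral comes from a genuine measure, which gives
    access to Tonelli's theorem and to countable subadditivity. The space is an iterated product
    whose type depends on [n], hence the existential; [phi] assembles the coordinates into a
    vector. *)
Lemma iint_measure n : exists (d : measure_display) (T : measurableType d)
  (mu : {sigma_finite_measure set T -> \bar R}) (phi : T -> borel_rV R n),
  measurable_fun setT phi /\
  forall f : borel_rV R n -> \bar R, measurable_fun setT f -> (forall x, 0 <= f x) ->
    iint f = \int[mu]_t f (phi t).
Proof.
elim: n => [|n [d [T [mu [phi [mphi IH]]]]]].
  exists _, unit, (@dirac _ unit tt R), (fun=> 0%R); split => // f mf f0 /=.
  by rewrite integral_dirac// diracT mul1e.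
exists _, _, (product_sigma_finite (@lebesgue_measure R) mu),
  (fun p : R * T => cons_rV p.1 (phi p.2)).
have mcons : measurable_fun [set: measurableTypeR R * T]
    (fun p : measurableTypeR R * T => cons_rV p.1 (phi p.2) : borel_rV R n.+1).
  apply: measurable_cons_rV; first exact: measurable_fst.
  by apply: measurableT_comp => //; exact: measurable_snd.
split=> // f mf f0.
rewrite fubini_tonelli1//=; last exact: (measurableT_comp mf mcons).
apply: eq_integral => x _; rewrite /fubini_F/=.
by rewrite (IH (fun v => f (cons_rV x v)))//; exact: measurable_slice.
Qed.

Lemma measurable_iint_slice n (f : borel_rV R n.+1 -> \bar R) :
  measurable_fun setT f -> (forall x, 0 <= f x) ->
  measurable_fun [set: measurableTypeR R] (fun x => iint (fun v => f (cons_rV x v))).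
Proof.
move=> mf f0; have [d [T [mu [phi [mphi IH]]]]] := iint_measure n.
rewrite (_ : (fun _ => _) = fubini_F mu
    (fun p : measurableTypeR R * T => f (cons_rV p.1 (phi p.2)))); last first.
  by apply/funext => x; rewrite /fubini_F IH//; exact: measurable_slice.
apply: measurable_fun_fubini_tonelli_F => //=.
apply: (measurableT_comp mf); apply: measurable_cons_rV; first exact: measurable_fst.
by apply: measurableT_comp => //; exact: measurable_snd.
Qed.

(** Tonelli's theorem makes the inner integral of [f] measurable, so the additivity of the lower
    integral applies in every coordinate while [g] stays arbitrary. *)
Lemma iintD n (f g : borel_rV R n -> \bar R) : measurable_fun setT f ->
  (forall x, 0 <= f x) -> (forall x, 0 <= g x) ->
  iint (fun x => f x + g x) = iint f + iint g.
Proof.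
elim: n f g => [|n IH] f g mf f0 g0 //=.
rewrite -ge0_integralD_nomeas; last 3 first.
- exact: measurable_iint_slice.
- by move=> x; exact: iint_ge0.
- by move=> x; exact: iint_ge0.
apply: eq_integral => x _; rewrite -IH//; exact: measurable_slice.
Qed.

End iint.

Section lint.
Variable R : realType.
Local Open Scope ereal_scope.

Lemma measurable_asbool_if n (B : set (borel_rV R n)) (f g : borel_rV R n -> \bar R) :
  measurable B -> measurable_fun setT f -> measurable_fun setT g ->
  measurable_fun setT (fun x => if `[< B x >] then f x else g x).
Proof.
move=> mB mf mg; apply: measurable_fun_ifT => //.
apply: (measurable_fun_bool true); rewrite setTI.
by congr measurable : mB; apply/seteqP; split=> x /asboolP.
Qed.

(** For Borel [B] this is its Lebesgue measure, in the form that [leb_null] uses. *)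
Definition iindic n (B : set 'rV[R]_n) : \bar R :=
  iint (fun x => if `[< B x >] then 1 else 0).

Lemma iindic_measure n : exists (d : measure_display) (T : measurableType d)
  (mu : {sigma_finite_measure set T -> \bar R}) (phi : T -> borel_rV R n),
  [/\ forall N : set (borel_rV R n), measurable N -> measurable (phi @^-1` N),
    (forall f : borel_rV R n -> \bar R, measurable_fun setT f -> (forall x, 0 <= f x) ->
      iint f = \int[mu]_t f (phi t)) &
    forall N : set (borel_rV R n), measurable N -> iindic N = mu (phi @^-1` N)].
Proof.
have [d [T [mu [phi [mphi IH]]]]] := iint_measure R n.
have mN (N : set (borel_rV R n)) : measurable N -> measurable (phi @^-1` N).
  by move=> mN; rewrite -[X in measurable X]setTI; exact: mphi.
exists d, T, mu, phi; split => // N /[dup] /mN mphiN mN'.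
rewrite /iindic IH//; last by move=> x; case: ifP.
  rewrite -(setIT (phi @^-1` N)) -integral_indic//.
  apply: eq_integral => t _; rewrite indicE; case: ifPn => [/asboolP Nt|/asboolPn Nt].
    by rewrite mem_set.
  by rewrite memNset.
exact: measurable_asbool_if.
Qed.

(** The function [o], infinite on [N] and 0 elsewhere, is Borel with integral 0. Since [a <= o + b]
    everywhere once [a] and [b] agree off [N], additivity is needed only with the measurable summand
    [o]. *)
Lemma iint_off_null n (N : set (borel_rV R n)) (f g : 'rV[R]_n -> \bar R) :
  measurable N -> iindic N = 0 -> (forall x, 0 <= f x) -> (forall x, 0 <= g x) ->
  (forall x, ~ N x -> f x = g x) -> iint f = iint g.
Proof.
move=> mN N0.
pose o (x : borel_rV R n) : \bar R := if `[< N x >] then +oo else 0.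
have mo : measurable_fun setT o by exact: measurable_asbool_if.
have o0 x : 0 <= o x by rewrite /o; case: ifP.
have io : iint o = 0.
  have [d [T [mu [phi [mphi IH muE]]]]] := iindic_measure n.
  have mNphi := mphi _ mN.
  have muN : mu (phi @^-1` N) = 0 by rewrite -muE.
  rewrite IH// (_ : (fun t => o (phi t)) = (fun t => +oo * (\1_(phi @^-1` N) t)%:E)).
    rewrite ge0_integralZl//; last exact/measurable_EFinP.
    by rewrite integral_indic// setIT [X in _ * X]muN mule0.
  apply/funext => t; rewrite /o indicE; case: ifPn => [/asboolP Nt|/asboolPn Nt].
    by rewrite mem_set// mule1.
  by rewrite memNset// mule0.
have le (a b : 'rV[R]_n -> \bar R) : (forall x, 0 <= a x) -> (forall x, 0 <= b x) ->
    (forall x, ~ N x -> a x = b x) -> iint a <= iint b.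
  move=> a0 b0 ab; rewrite -[leRHS]add0e -io -iintD//.
  apply: iint_le => // x; rewrite /o; case: ifPn => [|/asboolPn]; last first.
    by move=> /ab ->; rewrite add0e.
  by rewrite addye ?leey// gt_eqF// (lt_le_trans _ (b0 x)) ?ltNyr.
move=> f0 g0 fg; apply/eqP; rewrite eq_le !le// => x /fg //.
Qed.

Lemma iindic_bigcup n (B : nat -> set (borel_rV R n)) : (forall k, measurable (B k)) ->
  (forall k, iindic (B k) = 0) -> iindic (\bigcup_k B k) = 0.
Proof.
move=> mB B0; have [d [T [mu [phi [mphi _ E]]]]] := iindic_measure n.
rewrite E; last exact: bigcup_measurable.
rewrite preimage_bigcup; apply/eqP; rewrite -measure_le0.
have mBk k : measurable (phi @^-1` B k) by exact: mphi.
have := @measure_sigma_subadditive _ _ _ mu _ _ mBk (bigcupT_measurable _ mBk) (@subset_refl _ _).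
by rewrite eseries0// => k _ _; rewrite -[LHS]E.
Qed.

Lemma lint_le n (X : set 'rV[R]_n) (f g : 'rV[R]_n -> \bar R) :
  (forall x, X x -> 0 <= f x) -> (forall x, X x -> f x <= g x) ->
  lint X f <= lint X g.
Proof.
move=> f0 fg; apply: iint_le => x; case: ifPn => // /asboolP Xx.
- exact: f0.
- exact: fg.
Qed.

Lemma lintZ n (X : set 'rV[R]_n) (f : 'rV[R]_n -> \bar R) (c : R) : (0 <= c)%R ->
  (forall x, X x -> 0 <= f x) -> lint X (fun x => c%:E * f x) = c%:E * lint X f.
Proof.
move=> c0 f0; rewrite /lint -iintZ//; last first.
  by move=> x; case: ifPn => // /asboolP /f0.
by congr iint; apply/funext => x; case: ifP => // _; rewrite mule0.
Qed.

Lemma lint_ge0 n (X : set 'rV[R]_n) (f : 'rV[R]_n -> \bar R) :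
  (forall x, X x -> 0 <= f x) -> 0 <= lint X f.
Proof. by move=> f0; apply: iint_ge0 => x; case: ifPn => // /asboolP /f0. Qed.

Lemma eq_lint n (X : set 'rV[R]_n) (f g : 'rV[R]_n -> \bar R) :
  (forall x, X x -> f x = g x) -> lint X f = lint X g.
Proof.
move=> fg; congr iint; apply/funext => x; case: ifPn => // /asboolP; exact: fg.
Qed.

Definition measurable_on n (X : set 'rV[R]_n) (f : 'rV[R]_n -> \bar R) : Prop :=
  measurable_fun [set: borel_rV R n] (fun x => if `[< X x >] then f x else 0).

Lemma lintD n (X : set 'rV[R]_n) (f g : 'rV[R]_n -> \bar R) :
  measurable_on X f -> (forall x, X x -> 0 <= f x) -> (forall x, X x -> 0 <= g x) ->
  lint X (fun x => f x + g x) = lint X f + lint X g.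
Proof.
move=> mf f0 g0; rewrite /lint -iintD//; last 2 first.
- by move=> x; case: ifPn => // /asboolP /f0.
- by move=> x; case: ifPn => // /asboolP /g0.
by congr iint; apply/funext => x; case: ifP => // _; rewrite adde0.
Qed.

End lint.

(** * Alexandrov Hessians and the Legendre transform *)

Section dotv.
Variables (R : realType) (n : nat).
Implicit Types (x y z u v w : 'rV[R]_n) (A : 'M[R]_n) (a b c t : R).

Lemma dotvE x y : dotv x y = (x *m y^T) ord0 ord0.
Proof. by rewrite /dotv mxE; apply: eq_bigr => i _; rewrite mxE. Qed.

Lemma dotvC x y : dotv x y = dotv y x.
Proof. by apply: eq_bigr => i _; rewrite mulrC. Qed.

Lemma dotvDl x y z : dotv (x + y) z = dotv x z + dotv y z.
Proof. by rewrite !dotvE mulmxDl mxE. Qed.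

Lemma dotvZl t x z : dotv (t *: x) z = t * dotv x z.
Proof. by rewrite !dotvE -scalemxAl mxE. Qed.

Lemma dotvNl x z : dotv (- x) z = - dotv x z.
Proof. by rewrite -scaleN1r dotvZl mulN1r. Qed.

Lemma dotvDr x y z : dotv z (x + y) = dotv z x + dotv z y.
Proof. by rewrite dotvC dotvDl !(dotvC z). Qed.

Lemma dotvZr t x z : dotv z (t *: x) = t * dotv z x.
Proof. by rewrite dotvC dotvZl (dotvC z). Qed.

Lemma dotvNr x z : dotv z (- x) = - dotv z x.
Proof. by rewrite dotvC dotvNl (dotvC z). Qed.

Definition dotv_lin := (dotvDl, dotvDr, dotvNl, dotvNr, dotvZl, dotvZr).

Lemma dotv_ge0 x : 0 <= dotv x x.
Proof. by apply: sumr_ge0 => i _; rewrite -expr2 sqr_ge0. Qed.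

Lemma le_coord_dotv x i : x ord0 i ^+ 2 <= dotv x x.
Proof.
rewrite /dotv (bigD1 i)//= -expr2 lerDl.
by apply: sumr_ge0 => j _; rewrite -expr2 sqr_ge0.
Qed.

Lemma dotv_mulmx A x y : A^T = A -> dotv (x *m A) y = dotv x (y *m A).
Proof. by move=> As; rewrite !dotvE trmx_mul As mulmxA. Qed.

Lemma discr_le0 a b c : 0 <= c -> (forall t, 0 <= a + 2 * b * t + c * t ^+ 2) ->
  b ^+ 2 <= a * c.
Proof.
rewrite le_eqVlt => /predU1P[<- H|c0 H].
  have [->|b0] := eqVneq b 0; first by rewrite mulr0 expr0n.
  have := H (- (a + 1) / (2 * b)).
  rewrite mul0r addr0 mulrC divfK ?mulf_neq0//; lra.
have := H (- (b / c)).
have -> : a + 2 * b * - (b / c) + c * (- (b / c)) ^+ 2 = (a * c - b ^+ 2) / c.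
  by field; rewrite gt_eqF.
by rewrite pmulr_lge0 ?invr_gt0// subr_ge0.
Qed.

Lemma cauchy_schwarz_mx A x y : A^T = A -> (forall z, 0 <= dotv (z *m A) z) ->
  dotv (x *m A) y ^+ 2 <= dotv (x *m A) x * dotv (y *m A) y.
Proof.
move=> As A0; apply: discr_le0 => // t.
have := A0 (x + t *: y); rewrite mulmxDl -scalemxAl !dotv_lin.
rewrite (_ : dotv (y *m A) x = dotv (x *m A) y); first by lra.
by rewrite dotv_mulmx// dotvC.
Qed.

Lemma cauchy_schwarz x y : dotv x y ^+ 2 <= dotv x x * dotv y y.
Proof.
have := @cauchy_schwarz_mx 1%:M x y; rewrite !mulmx1; apply.
  exact: trmx1.
by move=> z; rewrite mulmx1 dotv_ge0.
Qed.

Lemma mulmx_bounded A : exists2 C : R, 0 < C &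
  forall x, dotv (x *m A) (x *m A) <= C * dotv x x.
Proof.
pose S := \sum_(j < n) dotv (col j A)^T (col j A)^T.
have S0 : 0 <= S by apply: sumr_ge0 => j _; exact: dotv_ge0.
exists (S + 1); first by rewrite ltr_wpDl.
move=> x; apply: (@le_trans _ _ (S * dotv x x)).
  rewrite [in leLHS]/dotv /S mulr_suml; apply: ler_sum => j _.
  rewrite mulrC -expr2 [in leRHS]mulrC (_ : (x *m A) ord0 j = dotv x (col j A)^T).
    exact: cauchy_schwarz.
  by rewrite /dotv mxE; apply: eq_bigr => i _; rewrite !mxE.
by rewrite ler_wpM2r ?dotv_ge0// lerDl.
Qed.

Lemma dotv_sum_sqr u v : dotv (u + v) (u + v) <= 2 * dotv u u + 2 * dotv v v.
Proof.
have := dotv_ge0 (u - v); rewrite !dotv_lin (dotvC v u); lra.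
Qed.

(** Put [y = z *m A]. Cauchy-Schwarz for the form of [A], applied to [z] and [y], bounds the square
    of [dotv y y] by [dotv y z * dotv (y *m A) y], hence [dotv y y] by a multiple of [dotv y z].
    Invertibility bounds [dotv z z] by a multiple of [dotv y y]. No eigenvalues are involved. *)
Lemma posdef_lower_bound A : A^T = A -> (forall z, 0 <= dotv (z *m A) z) ->
  A \in unitmx -> exists2 l : R, 0 < l & forall z, l * dotv z z <= dotv (z *m A) z.
Proof.
move=> As A0 Au; have [C C0 HC] := mulmx_bounded A.
have [D D0 HD] := mulmx_bounded (invmx A).
exists ((C + 1) * D)^-1; first by rewrite invr_gt0 mulr_gt0// addr_gt0.
move=> z; rewrite mulrC ler_pdivrMr ?mulr_gt0 ?addr_gt0//.
set y := z *m A.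
have zE : z = y *m invmx A by rewrite /y mulmxK.
have h1 : dotv z z <= D * dotv y y by rewrite {1 2}zE; exact: HD.
suff h2 : dotv y y <= (C + 1) * dotv y z by nra.
have h3 := @cauchy_schwarz_mx A z y As A0; rewrite -/y in h3.
(* Cauchy-Schwarz gives the square root of [C] as the factor; [C + 1] is a bound for it. *)
have h4 : dotv (y *m A) y <= (C + 1) * dotv y y.
  have h5 := HC y; have h6 := cauchy_schwarz (y *m A) y.
  have y0 := dotv_ge0 y; have h7 : dotv (y *m A) y ^+ 2 <= C * dotv y y ^+ 2 by nra.
  have h8 : dotv (y *m A) y ^+ 2 <= ((C + 1) * dotv y y) ^+ 2 by nra.
  by rewrite -ler_sqr ?nnegrE ?A0// mulr_ge0// addr_ge0// ltW.
have y0 := dotv_ge0 y; have z0 := A0 z; rewrite -/y in z0.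
have [y00|yn0] := eqVneq (dotv y y) 0; first by rewrite y00 mulr_ge0// addr_ge0// ltW.
have yp : 0 < dotv y y by rewrite lt_neqAle eq_sym yn0.
have h9 : dotv y y * dotv y y <= ((C + 1) * dotv y z) * dotv y y by nra.
by rewrite ler_pM2r in h9.
Qed.

End dotv.

Section alexandrov.
Variables (R : realType) (n : nat) (psi : 'rV[R]_n -> \bar R).
Hypothesis psiC : in_C psi.
Implicit Types (x y z p u v w : 'rV[R]_n) (A : 'M[R]_n).

Lemma in_C_finP y : (psi y < +oo)%E -> psi y \is a fin_num.
Proof. by have [h _ _] := psiC; rewrite fin_numE h lt_neqAle => /andP[]. Qed.

Lemma in_C_convex x y (t : R) : psi x \is a fin_num -> psi y \is a fin_num ->
  0 < t < 1 -> psi ((1 - t) *: x + t *: y) \is a fin_num /\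
  fine (psi ((1 - t) *: x + t *: y)) <= (1 - t) * fine (psi x) + t * fine (psi y).
Proof.
move=> fx fy t01; have [_ /(_ x y t t01) + _] := psiC.
rewrite -{1}(fineK fx) -{1}(fineK fy) -!EFinM -EFinD => H.
have fz : psi ((1 - t) *: x + t *: y) \is a fin_num.
  by apply: in_C_finP; rewrite (le_lt_trans H)// ltry.
by split => //; rewrite -(fineK fz) lee_fin in H.
Qed.

Lemma in_C_segment x v (t : R) : psi x \is a fin_num -> psi (v + x) \is a fin_num ->
  0 < t < 1 -> psi (t *: v + x) \is a fin_num /\
  fine (psi (t *: v + x)) <= (1 - t) * fine (psi x) + t * fine (psi (v + x)).
Proof.
move=> fx fy t01; have := in_C_convex fx fy t01.
suff -> : (1 - t) *: x + t *: (v + x) = t *: v + x by [].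
by rewrite scalerBl scale1r scalerDr addrC addrA addrAC addrK.
Qed.

Lemma small_scale (d c : R) : 0 < d -> 0 <= c ->
  exists2 s : R, 0 < s < 1 & s * c < d.
Proof.
move=> d0 c0; exists (d / (d + c + 1)).
  rewrite divr_gt0//=; last lra.
  by rewrite ltr_pdivrMr; lra.
by rewrite mulrAC ltr_pdivrMr; nra.
Qed.

(** If [psi] were below its tangent at [v + x], convexity would keep it below at [s *: v + x] by an
    amount linear in [s], while the expansion allows only an amount quadratic in [s]. *)
Lemma alex_subgradient x p A : alex psi x p A -> forall y,
  ((fine (psi x) + dotv p (y - x))%:E <= psi y)%E.
Proof.
move=> [_ [fx H]] y; have [h0 _ _] := psiC.
rewrite -{2}(subrK x y); move: (y - x) => v {y}; set y := v + x.
have [|] := eqVneq (psi y) +oo%E; first by move=> ->; rewrite leey.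
move=> yoo; have fy : psi y \is a fin_num by rewrite fin_numE h0.
rewrite -(fineK fy) lee_fin leNgt; apply/negP => lt.
have [d [d0 {}H]] := H 1 ltr01.
pose K := `|dotv (v *m A) v| + dotv v v.
have K0 : 0 <= K by rewrite addr_ge0// dotv_ge0.
pose e := Num.min d (fine (psi x) + dotv p v - fine (psi y)).
have e0 : 0 < e by rewrite lt_min d0 subr_gt0.
have [s /andP[s0 s1] sK] := small_scale e0 K0.
have v0 := dotv_ge0 v.
have vK : dotv v v <= K by rewrite lerDr.
have [fz Hz] := in_C_segment fx fy (introT andP (conj s0 s1)).
have svd : dotv (s *: v) (s *: v) < d.
  rewrite !dotv_lin; have : s * K < d by rewrite (lt_le_trans sK)// ge_min lexx.
  apply: le_lt_trans; rewrite ler_pM2l//; apply: (le_trans _ vK).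
  by rewrite ler_piMl// ltW.
have := H (s *: v + x); rewrite addrK => /(_ svd) [_].
rewrite -scalemxAl !dotv_lin => Hs.
have sKe : s * K < fine (psi x) + dotv p v - fine (psi y).
  by rewrite (lt_le_trans sK)// ge_min lexx orbT.
have := ler_norm (- dotv (v *m A) v); rewrite normrN => hA.
have := ler_norm (- (fine (psi (s *: v + x)) - fine (psi x) - s * dotv p v -
         2^-1 * (s * (s * dotv (v *m A) v)))).
rewrite normrN => hN.
have : K = `|dotv (v *m A) v| + dotv v v by [].
move=> KE.
have N0 : 0 <= `|dotv (v *m A) v| by [].
have ss : 0 <= s * s by rewrite mulr_ge0 ?ltW.
have h2 : 0 <= (s * s) * (`|dotv (v *m A) v| + dotv (v *m A) v).
  by rewrite mulr_ge0//; lra.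
have h3 := mulr_ge0 ss N0.
have h1 : s * (fine (psi x) + dotv p v - fine (psi y)) <= s * (s * K).
  rewrite KE; lra.
have h4 : s * (s * K) < s * (fine (psi x) + dotv p v - fine (psi y)) by rewrite ltr_pM2l.
lra.
Qed.

(** Along a direction of negative curvature the expansion would drop below the tangent, against
    [alex_subgradient]; [e] makes the error at most half of the quadratic term. *)
Lemma alex_psd x p A : alex psi x p A -> forall v, 0 <= dotv (v *m A) v.
Proof.
move=> H0 v; have sub := alex_subgradient H0; have [_ [fx H]] := H0.
have v0 := dotv_ge0 v.
rewrite leNgt; apply/negP => lt.
pose e := - dotv (v *m A) v / (4 * (dotv v v + 1)).
have e0 : 0 < e by rewrite divr_gt0; lra.
have [d [d0 {}H]] := H e e0.
have [s /andP[s0 s1] sK] := small_scale d0 v0.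
have svd : dotv (s *: v) (s *: v) < d.
  rewrite !dotv_lin; apply: le_lt_trans sK; rewrite ler_pM2l//.
  by rewrite ler_piMl// ltW.
have := H (s *: v + x); rewrite addrK => /(_ svd) [fz].
have := sub (s *: v + x); rewrite addrK -(fineK fz) lee_fin.
rewrite -scalemxAl !dotv_lin => Hsub Hs.
have hN := le_trans (ler_norm _) Hs.
have ss : 0 < s * s by rewrite mulr_gt0.
have : 0 <= s * s * (2^-1 * dotv (v *m A) v + e * dotv v v) by lra.
rewrite pmulr_rge0// => hh.
have : e * dotv v v <= - dotv (v *m A) v / 4.
  rewrite /e invfM mulrA -mulrA ler_piMr//; first by rewrite divr_ge0; lra.
  by rewrite mulrC ler_pdivrMr; lra.
lra.
Qed.

Lemma legendre_alex x p A : alex psi x p A ->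
  legendre psi p = (dotv x p - fine (psi x))%:E.
Proof.
move=> H0; have sub := alex_subgradient H0; have [_ [fx H]] := H0.
apply/eqP; rewrite eq_le; apply/andP; split; last first.
  by apply: ereal_sup_ubound; exists x => //; rewrite -[in LHS](fineK fx) EFinB.
apply: ge_ereal_sup => _ [y _ <-]; have := sub y.
case: (psi y) => [r| |].
- by rewrite -EFinB !lee_fin !dotv_lin (dotvC p y) (dotvC p x); lra.
- by move=> _; rewrite addeNy leNye.
- by rewrite leeNy_eq.
Qed.

Lemma legendre_upper x p A v q (U : R) : alex psi x p A ->
  (psi (v + x) \is a fin_num ->
     dotv q v - (fine (psi (v + x)) - fine (psi x) - dotv p v) <= U) ->
  ((dotv (v + x) (p + q))%:E - psi (v + x) <=
     (dotv x p - fine (psi x) + dotv x q + U)%:E)%E.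
Proof.
move=> H0 HU; have [h0 _ _] := psiC.
have [->|yoo] := eqVneq (psi (v + x)) +oo%E; first by rewrite addeNy leNye.
have fy : psi (v + x) \is a fin_num by rewrite fin_numE h0.
rewrite -(fineK fy) -EFinB lee_fin; have := HU fy.
by rewrite !dotv_lin (dotvC p v) (dotvC q v); lra.
Qed.

(** The quadratic model of [psi] at [x] has as conjugate the model with matrix [invmx A], and its
    maximum for the increment [q] is attained at [w = q *m invmx A]. Testing the supremum at [w + x]
    gives the lower bound. For the upper bound, nearby points are handled by completing the square
    and distant points by convexity. *)
Lemma alex_legendre x p A : alex psi x p A -> A \in unitmx ->
  alex (legendre psi) p x (invmx A).
Proof.
move=> H0 Au; have A0 := alex_psd H0; have sub := alex_subgradient H0.
have lp := legendre_alex H0; have [As [fx H]] := H0.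
have [l l0 Hl] := posdef_lower_bound As A0 Au.
have [C C0 HC] := mulmx_bounded (invmx A).
split; first by rewrite trmx_inv As.
split; first by rewrite lp.
move=> eps eps0.
(* The first bound turns the error in [w] into at most [eps * dotv q q]; the second lets the
   coercivity constant [l] absorb the rest. *)
pose e := Num.min (eps / (2 * C)) (l / 4).
have e0 : 0 < e by rewrite lt_min !divr_gt0// mulr_gt0.
have eC : 2 * e * C <= eps.
  have : e <= eps / (2 * C) by rewrite ge_min lexx.
  by rewrite ler_pdivlMr ?mulr_gt0//; lra.
have el : e <= l / 4 by rewrite ge_min lexx orbT.
have [d [d0 {}H]] := H e e0.
pose rho := d / 2; have rho0 : 0 < rho by rewrite divr_gt0.
(* The first bound puts [w] inside the region of the expansion; the second keeps [dotv q v] below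
   [l / 4 * rho] whenever [dotv v v = rho]. *)
pose d' := Num.min (d / C) ((l / 4) ^+ 2 * rho).
have d'0 : 0 < d' by rewrite lt_min divr_gt0//= mulr_gt0// exprn_gt0// divr_gt0.
exists d'; split => // y; rewrite -(subrK p y) addrK.
move: (y - p) => q {y}; rewrite addrC => qd.
pose w := q *m invmx A; have wA : w *m A = q by rewrite mulmxKV.
clearbody w.
have wq : dotv w w <= C * dotv q q.
  by rewrite (_ : w = q *m invmx A) ?HC// -wA mulmxK.
have q0 := dotv_ge0 q; have w0 := dotv_ge0 w.
have wd : dotv w w < d.
  apply: (le_lt_trans wq); rewrite mulrC -ltr_pdivlMr//.
  by rewrite (lt_le_trans qd)// ge_min lexx.
have qrho : dotv q q < (l / 4) ^+ 2 * rho.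
  by rewrite (lt_le_trans qd)// ge_min lexx orbT.
rewrite (_ : q *m invmx A = w); last by rewrite -wA mulmxK.
pose B := dotv x p - fine (psi x) + dotv x q.
have ew : 2 * e * dotv w w <= eps * dotv q q.
  by nra.
have lower : ((B + (2^-1 * dotv w q - eps * dotv q q))%:E <=
    legendre psi (p + q))%E.
  have := H (w + x); rewrite addrK => /(_ wd) [fz Hz].
  apply: (@le_trans _ _ ((dotv (w + x) (p + q))%:E - psi (w + x))%E); last first.
    by apply: ereal_sup_ubound; exists (w + x).
  rewrite -(fineK fz) -EFinB lee_fin.
  have hN := le_trans (ler_norm _) Hz.
  rewrite wA in hN; rewrite /B !dotv_lin (dotvC p w) in hN *.
  rewrite (dotvC q w) in hN.
  nra.
have upper : (legendre psi (p + q) <=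
    (B + (2^-1 * dotv w q + eps * dotv q q))%:E)%E.
  apply: ge_ereal_sup => _ [y _ <-]; rewrite -(subrK x y).
  move: (y - x) => v {y}; apply: (legendre_upper H0) => fy.
  have v0 := dotv_ge0 v; have [vd|vd] := ltP (dotv v v) d.
    have := H (v + x); rewrite addrK => /(_ vd) [_ Hz].
    have := ler_norm (- (fine (psi (v + x)) - fine (psi x) - dotv p v -
      2^-1 * dotv (v *m A) v)); rewrite normrN => /le_trans /(_ Hz) {}Hz.
    (* In terms of [z], the model value at [v] is [2^-1 * dotv w q - 2^-1 * dotv (z *m A) z], and
       the negative term absorbs the error in [z]. *)
    have [z vE] : exists z, v = w + z by exists (v - w); rewrite addrC subrK.
    have vz := dotv_sum_sqr w z; rewrite -vE in vz.
    have z0 := dotv_ge0 z; have lz := Hl z.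
    have vAv : dotv (v *m A) v = dotv w q + 2 * dotv q z + dotv (z *m A) z.
      rewrite vE mulmxDl wA !dotv_lin (dotvC q w).
      rewrite (_ : dotv (z *m A) w = dotv q z); last first.
        by rewrite dotv_mulmx// wA dotvC.
      lra.
    have qv : dotv q v = dotv w q + dotv q z by rewrite vE dotvDr (dotvC q w).
    have ez : e * dotv z z <= l / 4 * dotv z z by rewrite ler_wpM2r.
    have : e * dotv v v <= 2 * e * dotv w w + 2 * (e * dotv z z) by nra.
    lra.
  (* A distant [v] is scaled by [t] to squared length [rho]. There [psi] exceeds its tangent by at
     least [l / 4 * rho], while [dotv q (t *: v)] is at most that. By convexity the quantity to be
     bounded is then nonpositive at [v] itself. *)
  have vp : 0 < dotv v v by apply: lt_le_trans vd.
  pose t := Num.sqrt (rho / dotv v v).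
  have tt : t ^+ 2 = rho / dotv v v by rewrite sqr_sqrtr// divr_ge0// ltW.
  have t0 : 0 < t by rewrite sqrtr_gt0 divr_gt0.
  have t1 : t < 1.
    rewrite -ltr_sqr ?nnegrE ?ltW// tt expr1n ltr_pdivrMr// mul1r.
    by rewrite (lt_le_trans _ vd)// /rho; lra.
  have tv : dotv (t *: v) (t *: v) = rho.
    by rewrite !dotv_lin mulrA -expr2 tt divfK// gt_eqF.
  have tvd : dotv (t *: v) (t *: v) < d by rewrite tv /rho; lra.
  have [ft Ht] := in_C_segment fx fy (introT andP (conj t0 t1)).
  have := H (t *: v + x); rewrite addrK => /(_ tvd) [_].
  move=> Hz; have := ler_norm (- (fine (psi (t *: v + x)) - fine (psi x) -
    dotv p (t *: v) - 2^-1 * dotv ((t *: v) *m A) (t *: v))).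
  rewrite normrN => /le_trans /(_ Hz) {}Hz.
  have lt := Hl (t *: v); rewrite tv in Hz lt.
  have qt : dotv q (t *: v) <= l / 4 * rho.
    have h := cauchy_schwarz q (t *: v); rewrite tv in h.
    apply: (le_trans (ler_norm _)); rewrite -ler_sqr ?nnegrE//; last first.
      by rewrite mulr_ge0// ltW// divr_gt0.
    rewrite real_normK ?num_real//; apply: (le_trans h).
    rewrite (_ : (l / 4 * rho) ^+ 2 = (l / 4) ^+ 2 * rho * rho); last by ring.
    by rewrite ler_wpM2r// ltW.
  have erho : e * rho <= l / 4 * rho by rewrite ler_wpM2r// ltW.
  have : t * (dotv q v - (fine (psi (v + x)) - fine (psi x) - dotv p v)) <= 0.
    by move: qt Hz lt; rewrite !dotvZr; lra.
  rewrite pmulr_rle0// => /le_trans; apply.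
  have wq0 : 0 <= dotv w q by rewrite -wA dotvC A0.
  by rewrite addr_ge0// mulr_ge0// ltW.
have fl : legendre psi (p + q) \is a fin_num.
  rewrite fin_numE; apply/andP; split; apply/eqP => E.
    by move: lower; rewrite E leeNy_eq.
  by move: upper; rewrite E leye_eq.
split => //; move: lower upper; rewrite -(fineK fl) !lee_fin lp /= /B => L U.
by rewrite ler_norml; apply/andP; split; lra.
Qed.

Lemma grad_alex x : Xset psi x -> exists A, alex psi x (grad psi x) A.
Proof.
by move=> [_ [p [A [pA _]]]]; apply: (@xgetPex _ 0 [set p | exists A, alex psi x p A]);
  exists p, A.
Qed.

End alexandrov.

(** * Borel measurability of the set of regular points and of the gradient *)

Section borel_sets.
Variables (R : realType) (n : nat).
Implicit Types (x y v : 'rV[R]_n).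

Lemma near_rV (x : 'rV[R]_n) (P : set 'rV[R]_n) : (\forall y \near x, P y) <->
  exists2 e : R, 0 < e & forall y, (forall i, `|y ord0 i - x ord0 i| < e) -> P y.
Proof.
split=> [/nbhs_ballP[e /= e0 xe]|[e e0 xe]].
  exists e => // y ye; apply: xe; split=> // i j; rewrite /ball/= (ord1 i) distrC; exact: ye.
apply/nbhs_ballP; exists e => //= y [_ xy].
by apply: xe => i; have := xy ord0 i; rewrite /ball/= distrC.
Qed.

Lemma ratr_dense_rV (x : 'rV[R]_n) (P : set 'rV[R]_n) : (\forall y \near x, P y) ->
  exists q : 'rV[rat]_n, P (map_mx ratr q).
Proof.
move=> /near_rV[e e0 eP].
have /choice[q qP] : forall i, exists q : rat, `|ratr q - x ord0 i| < e.
  move=> i; have [] := @rat_in_itvoo R (x ord0 i) (x ord0 i + e); first by rewrite ltrDl.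
  by move=> q; rewrite in_itv/= => /andP[h1 h2]; exists q; rewrite gtr0_norm; lra.
by exists (\row_i q i); apply: eP => i; rewrite !mxE.
Qed.

Lemma measurable_le_set (d : measure_display) (T : measurableType d) (f g : T -> R) :
  measurable_fun setT f -> measurable_fun setT g ->
  measurable [set x | f x <= g x].
Proof.
move=> mf mg; have := measurable_funB mg mf measurableT (measurable_itv `[0, +oo[).
rewrite setTI; congr measurable; apply/seteqP.
by split=> x /=; rewrite in_itv/= andbT subr_ge0.
Qed.

Lemma measurable_eq_set (d : measure_display) (T : measurableType d) (f g : T -> R) :
  measurable_fun setT f -> measurable_fun setT g ->
  measurable [set x | f x = g x].
Proof.
move=> mf mg; have -> : [set x | f x = g x] =
    [set x | f x <= g x] `&` [set x | g x <= f x].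
  apply/seteqP; split=> x /= => [->|[h1 h2]]; first by [].
  by apply/le_anti; rewrite h1 h2.
by apply: measurableI; exact: measurable_le_set.
Qed.

Lemma open_borel (U : set 'rV[R]_n) : open U -> measurable (U : set (borel_rV R n)).
Proof. exact: sub_sigma_algebra. Qed.

Lemma closed_borel (U : set 'rV[R]_n) : closed U -> measurable (U : set (borel_rV R n)).
Proof.
move=> cU; rewrite -[U]setCK; apply: measurableC; apply: open_borel.
exact: closed_openC.
Qed.

Lemma measurable_continuous_on_open (W : set 'rV[R]_n) (f : 'rV[R]_n -> R) :
  open W -> (forall x, W x -> {for x, continuous f}) ->
  measurable_fun [set: borel_rV R n] (fun x => if `[< W x >] then f x else 0).
Proof.
move=> oW fW; apply: (measurability _ (RGenOpens.measurableE R)).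
move=> _ [_ [a [b ->] <-]]; rewrite setTI.
set P := _ @^-1` _.
have -> : P = (W `&` [set x | f x \in `]a, b[]) `|` (~` W `&` [set x | 0 \in `]a, b[]).
  apply/seteqP; split=> x; rewrite /P /=.
    by case: ifPn => [/asboolP|/asboolPn]; [left|right].
  by case=> -[Wx]; [rewrite asboolT|rewrite asboolF].
apply: measurableU; last first.
  apply: measurableI; first by apply: measurableC; exact: open_borel.
  have [h|h] := boolP (0 \in `]a, b[).
    by rewrite (_ : [set _ | _] = setT)//; apply/seteqP; split.
  by rewrite (_ : [set _ | _] = set0)//; apply/seteqP; split.
apply: open_borel; rewrite openE => x [Wx /= fx].
apply: filterI; first by move: oW; rewrite openE; apply.
exact: (fW x Wx _ (open_nbhs_nbhs
  (conj (@interval_open _ (BRight a) (BLeft b) isT isT) fx))).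
Qed.

Lemma measurable_translation v :
  measurable_fun [set: borel_rV R n] (fun x : borel_rV R n => (x + v)%R : borel_rV R n).
Proof.
apply: measurable_rV => i; under eq_fun do rewrite mxE.
by apply: measurable_funD => //; exact: measurable_coord.
Qed.

End borel_sets.

(** * Continuity of a convex function in the interior of its domain *)

Section local_boundedness.
Variables (R : realType) (n : nat) (psi : 'rV[R]_n -> \bar R).
Hypothesis psiC : in_C psi.
Implicit Types (x y z p u v w : 'rV[R]_n) (A : 'M[R]_n).

(** For convex [psi] this is the interior of the domain, in the form from which openness and
    continuity are read off. *)
Definition locally_bounded : set 'rV[R]_n :=
  [set x | exists M : R, \forall y \near x, (psi y <= M%:E)%E].

Lemma open_locally_bounded : open locally_bounded.
Proof.
rewrite openE => x [M xM]; rewrite /interior/=.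
by apply: (@filterS _ _ _ (fun z => \forall y \near z, (psi y <= M%:E)%E));
  [move=> z zM; exists M|exact: (near_join xM)].
Qed.

Lemma locally_bounded_fin x : locally_bounded x -> psi x \is a fin_num.
Proof.
by move=> [M /nbhs_singleton xM]; apply: in_C_finP => //; rewrite (le_lt_trans xM)// ltry.
Qed.

(** With [y = s *: u + x], convexity between [x] and [u + x] bounds [psi y] from above. Since [x] is
    the combination of [y] and [x - u] with weight [t = s / (1 + s)] on the latter, convexity also
    bounds [psi y] from below. *)
Lemma continuous_locally_bounded x : locally_bounded x ->
  {for x, continuous (fine \o psi)}.
Proof.
move=> Wx; have fx := locally_bounded_fin Wx; have [M /near_rV[r r0 xr]] := Wx.
have xM : fine (psi x) <= M.
  by rewrite -lee_fin fineK//; apply: xr => i; rewrite subrr normr0.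
suff H (e : R) : 0 < e -> \forall y \near x, `|fine (psi x) - fine (psi y)| < e.
  exact: (iffRL (@cvgrPdist_lt _ _ _ (nbhs x) _ (fine \o psi) (fine (psi x))) H).
move=> e0; apply/near_rV.
have K0 : 0 <= M - fine (psi x) by rewrite subr_ge0.
have [s /andP[s0 s1] sK] := small_scale e0 K0.
exists (s * r) => [|y yx]; first by rewrite mulr_gt0.
pose u := s^-1 *: (y - x).
have ui i : `|u ord0 i| < r.
  rewrite !mxE normrM gtr0_norm ?invr_gt0// mulrC ltr_pdivrMr// mulrC.
  exact: yx.
have yE : y = s *: u + x by rewrite /u scalerA mulfV ?gt_eqF// scale1r subrK.
clearbody u.
have uM : (psi (u + x) <= M%:E)%E by apply: xr => i; rewrite !mxE addrK; exact: ui.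
have uM' : (psi (x - u) <= M%:E)%E.
  by apply: xr => i; rewrite !mxE addrAC subrr add0r normrN; exact: ui.
have fu : psi (u + x) \is a fin_num by apply: in_C_finP => //; rewrite (le_lt_trans uM)// ltry.
have fu' : psi (x - u) \is a fin_num by apply: in_C_finP => //; rewrite (le_lt_trans uM')// ltry.
have [fy h1] := in_C_segment psiC fx fu (introT andP (conj s0 s1)).
rewrite -yE in fy h1.
pose t := s / (1 + s).
have s10 : 0 < 1 + s by rewrite addr_gt0.
have t0 : 0 < t by rewrite divr_gt0.
have t1 : t < 1 by rewrite ltr_pdivrMr// mul1r ltrDr.
have [_ h2] := in_C_convex psiC fy fu' (introT andP (conj t0 t1)).
have xE : (1 - t) *: y + t *: (x - u) = x.
  rewrite yE; apply/rowP => i; rewrite !mxE /t; move: (u ord0 i) (x ord0 i) => a b.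
  by field; rewrite gt_eqF.
rewrite xE in h2.
rewrite -(fineK fu) lee_fin in uM; rewrite -(fineK fu') lee_fin in uM'.
have h3 : (1 + s) * fine (psi x) <= fine (psi y) + s * M.
  have : (1 + s) * fine (psi x) <= (1 + s) * ((1 - t) * fine (psi y) + t * M).
    rewrite ler_pM2l//; apply: (le_trans h2); rewrite lerD2l ler_pM2l//.
  move/le_trans; apply; rewrite le_eqVlt; apply/orP; left; apply/eqP.
  by rewrite /t; field; rewrite gt_eqF.
have h4 : s * fine (psi (u + x)) <= s * M by rewrite ler_pM2l.
by rewrite /= distrC ltr_norml; apply/andP; split; lra.
Qed.

(** The value 0 off the open set makes this a total real function, which is Borel because it is
    continuous on that set. *)
Definition psi0 x : R := if `[< locally_bounded x >] then fine (psi x) else 0.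

Lemma psi0E x : locally_bounded x -> psi0 x = fine (psi x).
Proof. by move=> Wx; rewrite /psi0 asboolT. Qed.

Lemma measurable_psi0 : measurable_fun [set: borel_rV R n] psi0.
Proof.
apply: measurable_continuous_on_open; first exact: open_locally_bounded.
exact: continuous_locally_bounded.
Qed.

Lemma near_dotv (x : 'rV[R]_n) (d : R) : 0 < d ->
  \forall y \near x, dotv (y - x) (y - x) < d.
Proof.
move=> d0; apply/near_rV.
have n0 : 0 < n%:R + 1 :> R by rewrite ltr_wpDl.
have [s /andP[s0 s1] sn] := small_scale d0 (ltW n0).
exists s => // y yx; apply: (le_lt_trans _ sn).
apply: (@le_trans _ _ (\sum_(i < n) s)); last first.
  by rewrite sumr_const card_ord -[leLHS]mulr_natr ler_pM2l// lerDl.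
apply: ler_sum => i _; rewrite -expr2 !mxE -real_normK ?num_real//.
have := yx i; move: (normr_ge0 (y ord0 i - x ord0 i)); nra.
Qed.

Lemma alex_locally_bounded x p A : alex psi x p A -> locally_bounded x.
Proof.
move=> [_ [fx H]]; have [d [d0 {}H]] := H 1 ltr01.
have [C C0 HC] := mulmx_bounded A.
(* The linear and quadratic terms are bounded through the squares of [v - p] and of [v *m A - v];
   the constants are generous. *)
exists (fine (psi x) + dotv p p + (C + 3) * d); near=> y.
have yd : dotv (y - x) (y - x) < d by near: y; exact: near_dotv.
have [fy] := H y yd; rewrite -(fineK fy) lee_fin.
move: (y - x) yd => v vd /(le_trans (ler_norm _)) h.
have h1 := dotv_ge0 (v - p); have h2 := dotv_ge0 (v *m A - v); have h3 := HC v.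
rewrite !dotv_lin (dotvC v p) in h1; rewrite !dotv_lin (dotvC v (v *m A)) in h2.
have := dotv_ge0 v; have := dotv_ge0 p; nra.
Unshelve. all: by end_near. Qed.

End local_boundedness.

(** * The gradient and the Hessian as limits of difference quotients *)

Section difference_quotients.
Variables (R : realType) (n : nat) (psi : 'rV[R]_n -> \bar R).
Hypothesis psiC : in_C psi.
Implicit Types (x y z p u v w : 'rV[R]_n) (A : 'M[R]_n).
Local Notation f := (psi0 psi).
Local Notation E i := (delta_mx ord0 i : 'rV[R]_n).

Lemma dotv_delta x i : dotv x (E i) = x ord0 i.
Proof.
rewrite /dotv (bigD1 i)//= mxE !eqxx mulr1 big1 ?addr0// => j ji.
by rewrite mxE eqxx (negbTE ji) mulr0.
Qed.

Lemma dotv_mulmx_delta A i j : dotv (E i *m A) (E j) = A i j.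
Proof. by rewrite dotv_delta -rowE mxE. Qed.

(** The linear term is left in the quotient; it cancels in the polarisation of [hessl]. *)
Definition difq2 v (m : nat) x : R := m.+1%:R ^+ 2 * (f (m.+1%:R^-1 *: v + x) - f x).

Lemma cvg_shrink v x : (fun m => m.+1%:R^-1 *: v + x) @ \oo --> x.
Proof.
rewrite -[X in _ --> X]add0r; apply: cvgD; last exact: cvg_cst.
rewrite -[X in _ --> X](scale0r v); apply: cvgZ; last exact: cvg_cst.
exact: cvg_harmonic.
Qed.

Lemma alex_difq2 x p A v : alex psi x p A ->
  (fun m => difq2 v m x - m.+1%:R * dotv p v) @ \oo --> 2^-1 * dotv (v *m A) v.
Proof.
move=> H0; have Wx := alex_locally_bounded H0; have [_ [fx H]] := H0.
apply/cvgrPdist_le => /= e e0.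
have v0 := dotv_ge0 v.
pose e' := e / (dotv v v + 1).
have e'0 : 0 < e' by rewrite divr_gt0// ltr_wpDl.
have [d [d0 {}H]] := H e' e'0.
have near_m (P : set 'rV[R]_n) : (\forall y \near x, P y) ->
    \forall m \near \oo, P (m.+1%:R^-1 *: v + x) by exact: (@cvg_shrink v x P).
near=> m.
have Wm : locally_bounded psi (m.+1%:R^-1 *: v + x).
  near: m; apply: near_m; have := @open_locally_bounded R n psi.
  by rewrite openE => /(_ _ Wx).
have dm : dotv (m.+1%:R^-1 *: v) (m.+1%:R^-1 *: v) < d.
  near: m; have := near_m _ (@near_dotv R n x d d0).
  by apply: filterS => m; rewrite addrK.
rewrite /difq2 !psi0E//.
have := H (m.+1%:R^-1 *: v + x); rewrite addrK => /(_ dm) [_].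
have k0 : 0 < m.+1%:R :> R by [].
rewrite -scalemxAl !dotv_lin; move: (m.+1%:R : R) k0 => k k0 h.
rewrite distrC; set a := fine _ in h *; set b := fine _ in h *.
have -> : k ^+ 2 * (a - b) - k * dotv p v - 2^-1 * dotv (v *m A) v =
  k ^+ 2 * (a - b - k^-1 * dotv p v - 2^-1 * (k^-1 * (k^-1 * dotv (v *m A) v))).
  by field; rewrite gt_eqF.
rewrite normrM (ger0_norm (exprn_ge0 2 (ltW k0))).
apply: (@le_trans _ _ (k ^+ 2 * (e' * (k^-1 * (k^-1 * dotv v v))))).
  by rewrite ler_pM2l// exprn_gt0.
have -> : k ^+ 2 * (e' * (k^-1 * (k^-1 * dotv v v))) = e' * dotv v v.
  by field; rewrite gt_eqF.
rewrite /e' mulrAC ler_pdivrMr ?ltr_wpDl// ler_pM2l//; lra.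
Unshelve. all: by end_near. Qed.

(** An upper limit exists and is Borel at every point, even where [psi] has no gradient. *)
Definition gradl x : 'rV[R]_n := \row_i fine (limn_esup (fun m : nat =>
  (m.+1%:R * (f (m.+1%:R^-1 *: E i + x) - f x))%:E)).

(** Polarisation of half the quadratic form of the Hessian. *)
Definition hessl x : 'M[R]_n := \matrix_(i, j) fine (limn_esup (fun m : nat =>
  (difq2 (E i + E j) m x - difq2 (E i) m x - difq2 (E j) m x)%:E)).

Lemma alex_gradl x p A : alex psi x p A -> gradl x = p.
Proof.
move=> H0; apply/rowP => i; rewrite mxE.
suff /cvg_limn_einf_sup[_ ->] : (fun m : nat =>
    (m.+1%:R * (f (m.+1%:R^-1 *: E i + x) - f x))%:E) @ \oo --> (p ord0 i)%:E by [].
apply: cvg_EFin; first exact: nearW.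
have := @alex_difq2 x p A (E i) H0; rewrite dotv_delta => h.
have : (fun m : nat => harmonic m * (difq2 (E i) m x - m.+1%:R * p ord0 i) +
    p ord0 i) @ \oo --> 0 * (2^-1 * dotv (E i *m A) (E i)) + p ord0 i.
  apply: cvgD; last exact: cvg_cst.
  by apply: cvgM; [exact: cvg_harmonic|exact: h].
rewrite mul0r add0r; apply: cvg_trans.
apply: near_eq_cvg; near=> m; rewrite /= /difq2 /harmonic/=.
by field; rewrite gt_eqF ?ltr_wpDr.
Unshelve. all: by end_near. Qed.

Lemma alex_hessl x p A : alex psi x p A -> hessl x = A.
Proof.
move=> H0; apply/matrixP => i j; rewrite mxE.
suff /cvg_limn_einf_sup[_ ->] : (fun m : nat =>
  (difq2 (E i + E j) m x - difq2 (E i) m x - difq2 (E j) m x)%:E) @ \oo -->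
  (A i j)%:E by [].
apply: cvg_EFin; first exact: nearW.
pose D v (m : nat) := difq2 v m x - m.+1%:R * dotv p v.
have : (fun m : nat => D (E i + E j) m - D (E i) m - D (E j) m) @ \oo -->
    2^-1 * dotv ((E i + E j) *m A) (E i + E j) - 2^-1 * dotv (E i *m A) (E i) -
    2^-1 * dotv (E j *m A) (E j).
  by apply: cvgB; [apply: cvgB|]; exact: alex_difq2.
rewrite mulmxDl !dotv_lin !dotv_mulmx_delta.
have [As _] := H0; have Aij : A j i = A i j by rewrite -{1}As mxE.
rewrite Aij (_ : _ - _ - _ = A i j); last by field.
apply: cvg_trans; apply: near_eq_cvg; near=> m.
by rewrite /D/= !dotv_lin; ring.
Unshelve. all: by end_near. Qed.

Lemma measurable_shift v (c : R) :
  measurable_fun [set: borel_rV R n] (fun x => f (c *: v + x)).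
Proof.
under eq_fun do rewrite addrC.
exact: (measurableT_comp (measurable_psi0 psiC) (measurable_translation _)).
Qed.

Lemma measurable_difq2 v m : measurable_fun [set: borel_rV R n] (difq2 v m).
Proof.
apply: measurable_funM => //; apply: measurable_funB; first exact: measurable_shift.
exact: measurable_psi0.
Qed.

Lemma measurable_gradl : measurable_fun [set: borel_rV R n] (gradl : borel_rV R n -> borel_rV R n).
Proof.
apply: measurable_rV => i; under eq_fun do rewrite mxE.
apply: (measurableT_comp (fine_measurable measurableT)).
apply: measurable_fun_limn_esup => m; apply/measurable_EFinP.
apply: measurable_funM => //; apply: measurable_funB; first exact: measurable_shift.
exact: measurable_psi0.
Qed.

Lemma measurable_hessl i j : measurable_fun [set: borel_rV R n] (fun x : borel_rV R n => hessl x i j).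
Proof.
under eq_fun do rewrite mxE.
apply: (measurableT_comp (fine_measurable measurableT)).
apply: measurable_fun_limn_esup => m; apply/measurable_EFinP.
by apply: measurable_funB; [apply: measurable_funB|]; exact: measurable_difq2.
Qed.

End difference_quotients.

Section Xset_borel.
Variables (R : realType) (n : nat) (psi : 'rV[R]_n -> \bar R).
Hypothesis psiC : in_C psi.
Implicit Types (x y z p u v w : 'rV[R]_n) (A : 'M[R]_n).
Local Notation f := (psi0 psi).

Definition remainder x v : R :=
  f (v + x) - f x - dotv (gradl psi x) v - 2^-1 * dotv (v *m hessl psi x) v.

Lemma cvg_bigsum (T I : Type) (F : set_system T) {FF : Filter F} (s : seq I)
  (h : I -> T -> R) (l : I -> R) : (forall i, h i @ F --> l i) ->
  (fun t => \sum_(i <- s) h i t) @ F --> \sum_(i <- s) l i.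
Proof.
move=> hl; elim: s => [|i s IH].
  by rewrite big_nil; under eq_fun do rewrite big_nil; exact: cvg_cst.
rewrite big_cons; under eq_fun do rewrite big_cons.
exact: cvgD.
Qed.

Lemma cvg_dotv (T : Type) (F : set_system T) {FF : Filter F} (g h : T -> 'rV[R]_n) u v :
  (forall i, (fun t => g t ord0 i) @ F --> u ord0 i) ->
  (forall i, (fun t => h t ord0 i) @ F --> v ord0 i) ->
  (fun t => dotv (g t) (h t)) @ F --> dotv u v.
Proof. by move=> cg ch; apply: cvg_bigsum => i; exact: cvgM. Qed.

Lemma cvg_coord v i : (fun u => u ord0 i) @ v --> v ord0 i.
Proof. exact: coord_continuous. Qed.

Lemma cvg_quadratic A v : (fun u => dotv (u *m A) u) @ v --> dotv (v *m A) v.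
Proof.
apply: (@cvg_dotv _ (nbhs v)) => i; last exact: cvg_coord.
rewrite mxE; under eq_fun do rewrite mxE.
by apply: (@cvg_bigsum _ _ (nbhs v)) => j; apply: cvgM; [exact: cvg_coord|exact: cvg_cst].
Qed.

Lemma cvg_psi0 x v : locally_bounded psi (v + x) ->
  (fun u => f (u + x)) @ v --> f (v + x).
Proof.
move=> Wv; have c1 : (fun u => u + x) @ v --> v + x.
  move=> P /near_rV[e e0 eP]; apply/near_rV; exists e => // y yv.
  by apply: eP => i; rewrite !mxE opprD addrACA subrr addr0; exact: yv.
rewrite psi0E//.
have c2 := cvg_comp _ _ c1 (continuous_locally_bounded psiC Wv).
have c3 : \forall u \near v, fine (psi (u + x)) = f (u + x).
  have := @open_locally_bounded R n psi; rewrite openE => /(_ _ Wv) Wn.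
  suff : nbhs (v + x) [set y | fine (psi y) = f y] by move/c1.
  by apply: filterS Wn => y Wy; rewrite /= psi0E.
apply: (cvg_trans _ c2); exact: (@near_eq_cvg _ _ (nbhs v) _ _ _ c3).
Qed.

Lemma cvg_remainder x v : locally_bounded psi (v + x) ->
  (fun u => remainder x u) @ v --> remainder x v.
Proof.
move=> Wv; rewrite /remainder; apply: (@cvgB _ _ _ (nbhs v)); last first.
  by apply: (@cvgM _ _ (nbhs v)); [exact: cvg_cst|exact: cvg_quadratic].
apply: (@cvgB _ _ _ (nbhs v)); last first.
  by apply: (@cvg_dotv _ (nbhs v)) => i; [exact: cvg_cst|exact: cvg_coord].
by apply: (@cvgB _ _ _ (nbhs v)); [exact: cvg_psi0|exact: cvg_cst].
Qed.

(** Gradient and Hessian can only be [gradl] and [hessl], so the existential over them disappears.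
    The remaining quantifiers become countable: errors 1/(k+1), radii 1/(m+1) and rational
    increments, the last because the remainder is continuous in the increment. *)
Lemma XsetE : Xset psi = locally_bounded psi `&`
  ([set x | forall i j, hessl psi x i j = hessl psi x j i] `&`
  (~` [set x | \det (hessl psi x) = 0] `&`
  [set x | forall k : nat, exists m : nat, forall q : 'rV[rat]_n,
    ((dotv (map_mx ratr q) (map_mx ratr q) : R) < m.+1%:R^-1) ->
    `|remainder x (map_mx ratr q)| <=
       k.+1%:R^-1 * (dotv (map_mx ratr q) (map_mx ratr q))])).
Proof.
apply/seteqP; split=> x.
  move=> [_ [p [A [H0 Au]]]].
  have Wx := alex_locally_bounded H0; split => //.
  have E1 := alex_gradl H0; have E2 := alex_hessl H0; have [As [fx H]] := H0.
  split; first by move=> i j /=; rewrite E2 -{1}As mxE.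
  split; first by rewrite /= E2 => /eqP; apply/negP; move: Au; rewrite unitmxE unitfE.
  move=> k; have k0 : 0 < k.+1%:R^-1 :> R by rewrite invr_gt0.
  have [d [d0 {}H]] := H _ k0.
  have := @open_locally_bounded R n psi; rewrite openE => /(_ _ Wx) /near_rV[r r0 rW].
  (* The bound [r ^+ 2] keeps [v + x] where [psi0] agrees with [psi]. *)
  pose e := Num.min d (r ^+ 2).
  have e0 : 0 < e by rewrite lt_min d0 exprn_gt0.
  have [m me] : exists m : nat, m.+1%:R^-1 < e.
    exists (Num.truncn e^-1); rewrite invf_plt ?posrE//; exact: truncnS_gt.
  exists m => q qm; set v := map_mx ratr q in qm *.
  have ve := lt_trans qm me.
  have vd : dotv v v < d by rewrite (lt_le_trans ve)// ge_min lexx.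
  have vr : dotv v v < r ^+ 2 by rewrite (lt_le_trans ve)// ge_min lexx orbT.
  have Wv : locally_bounded psi (v + x).
    apply: rW => i; rewrite mxE addrK -ltr_sqr ?nnegrE// ?ltW//.
    by rewrite real_normK ?num_real// (le_lt_trans (le_coord_dotv v i)).
  have := H (v + x); rewrite addrK => /(_ vd) [_].
  by rewrite /remainder !psi0E// E1 E2.
move=> [Wx [Qs [Qdet H]]]; have fx := locally_bounded_fin psiC Wx.
split; first by move: fx; rewrite fin_numE => /andP[_]; rewrite ltey.
exists (gradl psi x), (hessl psi x); split; last first.
  by rewrite unitmxE unitfE; apply/eqP.
split; first by apply/matrixP => i j; rewrite mxE.
split => // eps eps0.
have [k ke] : exists k : nat, k.+1%:R^-1 < eps.
  by exists (Num.truncn eps^-1); rewrite invf_plt ?posrE//; exact: truncnS_gt.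
have [m {}H] := H k.
have := @open_locally_bounded R n psi; rewrite openE => /(_ _ Wx) /near_rV[r r0 rW].
have m0 : 0 < m.+1%:R^-1 :> R by rewrite invr_gt0.
exists (Num.min m.+1%:R^-1 (r ^+ 2)); split; first by rewrite lt_min m0 exprn_gt0.
move=> y; rewrite -(subrK x y) addrK; move: (y - x) => v {y}.
rewrite lt_min => /andP[vm vr].
have Wv : locally_bounded psi (v + x).
  apply: rW => i; rewrite mxE addrK -ltr_sqr ?nnegrE// ?ltW//.
  by rewrite real_normK ?num_real// (le_lt_trans (le_coord_dotv v i)).
split; first exact: (locally_bounded_fin psiC).
have -> : fine (psi (v + x)) - fine (psi x) - dotv (gradl psi x) v -
    2^-1 * dotv (v *m hessl psi x) v = remainder x v by rewrite /remainder !psi0E.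
apply: (@le_trans _ _ (k.+1%:R^-1 * dotv v v)); last first.
  by rewrite ler_wpM2r ?dotv_ge0// ltW.
rewrite leNgt; apply/negP => lt.
have cq : (fun u => dotv u u) @ v --> dotv v v.
  by apply: (@cvg_dotv _ (nbhs v)) => i; exact: cvg_coord.
(* A violation at a real increment persists nearby, hence at a rational one. *)
have c1 : \forall u \near v, 0 < `|remainder x u| - k.+1%:R^-1 * dotv u u.
  have c : (fun u => `|remainder x u| - k.+1%:R^-1 * dotv u u) @ v -->
      `|remainder x v| - k.+1%:R^-1 * dotv v v.
    apply: (@cvgB _ _ _ (nbhs v)); first by apply: (@cvg_norm _ _ _ (nbhs v)); exact: cvg_remainder.
    by apply: (@cvgM _ _ (nbhs v)); [exact: cvg_cst|exact: cq].
  apply: (c [set a : R | 0 < a]); apply: open_nbhs_nbhs; split; first exact: open_gt.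
  by rewrite /= subr_gt0.
have c2 : \forall u \near v, dotv u u < m.+1%:R^-1.
  by apply: (cq [set a : R | a < m.+1%:R^-1]); apply: open_nbhs_nbhs; split => //; exact: open_lt.
have [q [q1 q2]] := ratr_dense_rV (filterI c1 c2).
by have := H q q2; rewrite leNgt => /negP; apply; rewrite -subr_gt0.
Qed.

Lemma measurable_Xset : measurable (Xset psi : set (borel_rV R n)).
Proof.
rewrite XsetE; apply: measurableI.
  by apply: open_borel; exact: open_locally_bounded.
apply: measurableI.
  apply: measurable_forall => i; apply: measurable_forall => j.
  by apply: measurable_eq_set; exact: measurable_hessl.
apply: measurableI.
  apply: measurableC; apply: measurable_eq_set => //.
  apply: measurable_sum => s; apply: measurable_funM => //.
  by apply: measurable_prod => i _; exact: measurable_hessl.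
apply: measurable_forall => k; apply: measurable_exists => m.
apply: measurable_forall => q; set v := map_mx ratr q.
have [h|h] := boolP (dotv v v < m.+1%:R^-1); last first.
  by rewrite [X in measurable X](_ : _ = setT)//; apply/seteqP; split.
rewrite [X in measurable X](_ : _ =
  [set x | `|remainder x v| <= k.+1%:R^-1 * dotv v v]); last first.
  by apply/seteqP; split => [x /= /(_ isT)|x /=].
apply: measurable_le_set => //; apply: measurableT_comp => //.
rewrite /remainder.
have mf : measurable_fun [set: borel_rV R n] (fun x : borel_rV R n => f (v + x)).
  by have := measurable_shift psiC v 1; under eq_fun do rewrite scale1r.
apply: measurable_funB; last first.
  apply: measurable_funM => //; apply: measurable_sum => i.
  apply: measurable_funM => //; under eq_fun do rewrite mxE.
  apply: measurable_sum => j; apply: measurable_funM => //; exact: measurable_hessl.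
apply: measurable_funB; last first.
  apply: measurable_sum => i; apply: measurable_funM => //.
  exact: (measurableT_comp (@measurable_coord R n i) (measurable_gradl psiC)).
by apply: measurable_funB => //; exact: measurable_psi0.
Qed.

Lemma grad_gradl x : Xset psi x -> grad psi x = gradl psi x.
Proof. by move=> /grad_alex[A H]; rewrite (alex_gradl H). Qed.

Lemma fine_psi0 x : Xset psi x -> fine (psi x) = f x.
Proof. by move=> /grad_alex[A H]; rewrite psi0E//; exact: alex_locally_bounded H. Qed.

End Xset_borel.

(** * Boundaries of convex sets and log-concave functions *)

Section convex_boundary.
Variable R : realType.

Definition convset n (K : set 'rV[R]_n) : Prop :=
  forall x y (t : R), K x -> K y -> 0 < t < 1 -> K ((1 - t) *: x + t *: y).

Lemma closureP_rV n (K : set 'rV[R]_n) x : closure K x <->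
  forall e : R, 0 < e -> exists2 y, K y & forall i, `|y ord0 i - x ord0 i| < e.
Proof.
split=> [Kx e e0|H B /near_rV[e e0 eB]].
  have [|y [Ky yB]] := Kx [set y | forall i, `|y ord0 i - x ord0 i| < e].
    by apply/near_rV; exists e.
  by exists y.
by have [y Ky yx] := H e e0; exists y; split => //; exact: eB.
Qed.

Lemma coord_bound n (u : 'rV[R]_n) : exists2 M : R, 0 <= M & forall i, `|u ord0 i| <= M.
Proof.
exists (\sum_i `|u ord0 i|); first exact: sumr_ge0.
by move=> i; rewrite (bigD1 i)//= lerDl sumr_ge0.
Qed.

Lemma cons_rV_mix n (s x c : R) (u w : 'rV[R]_n) :
  (1 - s) *: cons_rV x u + s *: cons_rV c w =
  cons_rV ((1 - s) * x + s * c) ((1 - s) *: u + s *: w).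
Proof.
have mix m (a b : 'rV[R]_m) i : ((1 - s) *: a + s *: b) ord0 i =
    (1 - s) * a ord0 i + s * b ord0 i by rewrite !mxE.
apply/rowP => i; rewrite mix.
by have [j ->|->] := fintype.unliftP ord0 i; rewrite ?cons_rV0 ?cons_rVS ?mix.
Qed.

Lemma cons_rV_near n (x : R) (v : 'rV[R]_n) (y : 'rV[R]_n.+1) (e : R) :
  (forall i, `|y ord0 i - cons_rV x v ord0 i| < e) -> exists x' v',
  [/\ y = cons_rV x' v', `|x' - x| < e & forall i, `|v' ord0 i - v ord0 i| < e].
Proof.
have [x' [v' ->]] := rV_consP y => H; exists x', v'; split => //.
  by have := H ord0; rewrite !cons_rV0.
by move=> i; have := H (lift ord0 i); rewrite !cons_rVS.
Qed.

Section slices.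
Variables (n : nat) (K : set 'rV[R]_n.+1).
Hypothesis cK : convset K.
Variables (x c : R) (v w : 'rV[R]_n).
Hypothesis cx : c != x.
Hypothesis Kcw : K (cons_rV c w).

(** The sign condition says that [x'] is on the same side of [x] as [c]. Then [cons_rV x' v'] lies
    on a segment from [cons_rV c w] to a point over [x], and that point stays in the given cube when
    [x'] and [v'] are close to [x] and [v]. *)
Lemma interior_slice (r : R) : 0 < r ->
  (forall u : 'rV[R]_n, (forall i, `|u ord0 i - v ord0 i| < r) -> K (cons_rV x u)) ->
  exists2 e : R, 0 < e & forall x' (v' : 'rV[R]_n), 0 <= (x' - x) / (c - x) -> `|x' - x| < e ->
    (forall i, `|v' ord0 i - v ord0 i| < e) -> K (cons_rV x' v').
Proof.
move=> r0 Kr; have [M M0 HM] := coord_bound (v - w).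
have b0 : 0 < `|c - x| by rewrite normr_gt0 subr_eq0.
have d0 : 0 < Num.min (r / 2) (`|c - x| / 2) by rewrite lt_min !divr_gt0.
have c0 : 0 <= 1 + M / `|c - x| by rewrite addr_ge0// divr_ge0.
(* The [|c - x| / 2] bound gives [s < 1 / 2]; the [r / 2] bound then keeps [u] within [r] of [v]. *)
have [e /andP[e0 e1]] := small_scale d0 c0; rewrite lt_min => /andP[he1 he2].
have eb : e < `|c - x| / 2.
  apply: le_lt_trans he2; rewrite ler_peMr ?(ltW e0)// lerDl divr_ge0//.
exists e => // x' v' s0 x'e v'e; set s := (x' - x) / (c - x) in s0.
have sE : s = `|x' - x| / `|c - x| by rewrite -[LHS]ger0_norm// normrM normfV.
have s_lt : s < e / `|c - x| by rewrite sE ltr_pM2r ?invr_gt0.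
have s12 : s < 1 / 2.
  by apply: (lt_le_trans s_lt); rewrite ler_pdivrMr//; lra.
have [s00|s_neq0] := eqVneq s 0.
  have -> : x' = x.
    apply/eqP; rewrite -subr_eq0; move/eqP : s00.
    by rewrite mulf_eq0 invr_eq0 [c - x == 0]subr_eq0 (negbTE cx) orbF.
  apply: Kr => i; apply: (lt_trans (v'e i)).
  have : e * 1 <= e * (1 + M / `|c - x|) by rewrite ler_pM2l// lerDl divr_ge0.
  lra.
have sp : 0 < s by rewrite lt_neqAle eq_sym s_neq0.
pose u := (1 - s)^-1 *: (v' - s *: w).
have s1 : 1 - s != 0 by rewrite gt_eqF; lra.
have -> : cons_rV x' v' = (1 - s) *: cons_rV x u + s *: cons_rV c w.
  rewrite cons_rV_mix; congr cons_rV.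
    rewrite /s; field; rewrite subr_eq0//.
  by rewrite /u scalerA mulfV// scale1r subrK.
apply: cK => //; last by apply/andP; split; lra.
apply: Kr => i; rewrite !mxE.
have := HM i; rewrite !mxE; have := v'e i.
move: (v' ord0 i) (v ord0 i) (w ord0 i) => a b d ab bd.
have -> : (1 - s)^-1 * (a - s * d) - b = (1 - s)^-1 * (a - b + s * (b - d)) by field.
rewrite normrM gtr0_norm ?invr_gt0; last lra.
rewrite mulrC ltr_pdivrMr; last lra.
apply: (le_lt_trans (ler_normD _ _)); rewrite normrM (gtr0_norm sp).
have h1 : s * `|b - d| <= e / `|c - x| * M.
  by apply: ler_pM => //; exact: ltW.
have h2 : e / `|c - x| * M = e * (1 + M / `|c - x|) - e by ring.
have h3 : r / 2 < r * (1 - s) by nra.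
lra.
Qed.

(** Here [x'] is on the side of [x] away from [c], so the segment from [cons_rV x' v'] to
    [cons_rV c w] crosses the slice over [x], at parameter [s = a / (1 + a)] and close to [v]. *)
Lemma closure_slice (e : R) : 0 < e ->
  exists2 e' : R, 0 < e' & forall x' (v' : 'rV[R]_n), (x' - x) / (c - x) <= 0 -> `|x' - x| < e' ->
    (forall i, `|v' ord0 i - v ord0 i| < e') -> K (cons_rV x' v') ->
    exists2 u : 'rV[R]_n, K (cons_rV x u) & forall i, `|u ord0 i - v ord0 i| < e.
Proof.
move=> e0; have [M M0 HM] := coord_bound (w - v).
have b0 : 0 < `|c - x| by rewrite normr_gt0 subr_eq0.
have c0 : 0 <= 2 + M / `|c - x| by rewrite addr_ge0// divr_ge0.
have [d /andP[d0 d1] hd] := small_scale e0 c0.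
exists d => // x' v' s0 x'd v'd Kx'.
have [xx'|xx'] := eqVneq x' x.
  exists v'; first by rewrite -xx'.
  move=> i; apply: (lt_trans (v'd i)).
  have : 0 <= d * (M / `|c - x|) by rewrite mulr_ge0 ?(ltW d0)// divr_ge0.
  lra.
have cx0 : c - x != 0 by rewrite subr_eq0.
pose a := - ((x' - x) / (c - x)).
have aE : a = `|x' - x| / `|c - x|.
  by rewrite /a -[LHS]ger0_norm ?oppr_ge0// normrN normrM normfV.
have a0 : 0 < a by rewrite aE divr_gt0// normr_gt0 subr_eq0.
have x'E : x' = x - a * (c - x) by rewrite /a mulNr divfK// opprK addrC subrK.
pose s := a / (1 + a); have a10 : 0 < 1 + a by lra.
have sp : 0 < s by rewrite divr_gt0.
have s1 : s < 1 by rewrite ltr_pdivrMr//; lra.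
have sa : s <= a by rewrite ler_pdivrMr//; nra.
exists ((1 - s) *: v' + s *: w).
  have -> : cons_rV x ((1 - s) *: v' + s *: w) = (1 - s) *: cons_rV x' v' + s *: cons_rV c w.
    rewrite cons_rV_mix; congr cons_rV; rewrite x'E /s; field; lra.
  by apply: cK => //; apply/andP.
clearbody s; move=> i; rewrite !mxE; have := HM i; rewrite !mxE; have := v'd i.
move: (v' ord0 i) (v ord0 i) (w ord0 i) => a' b' d' ab bd.
have -> : (1 - s) * a' + s * d' - b' = (1 - s) * (a' - b') + s * (d' - b') by ring.
apply: (le_lt_trans (ler_normD _ _)); rewrite !normrM (gtr0_norm sp) gtr0_norm; last lra.
have h1 : s * `|d' - b'| <= d / `|c - x| * M.
  apply: ler_pM => //; first exact: ltW.
  by apply: (le_trans sa); rewrite aE ler_pM2r ?invr_gt0// ltW.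
have h2 : d / `|c - x| * M = d * (2 + M / `|c - x|) - 2 * d by ring.
have h3 : (1 - s) * `|a' - b'| <= d by have := normr_ge0 (a' - b'); nra.
lra.
Qed.

End slices.
Lemma boundary_borel n (K : set 'rV[R]_n) :
  measurable (closure K `\` K° : set (borel_rV R n)).
Proof.
apply: measurableD; first by apply: closed_borel; exact: closed_closure.
by apply: open_borel; exact: open_interior.
Qed.

Lemma integral_off_pair (phi : R -> \bar R) (a b : R) : (forall x, 0 <= phi x)%E ->
  (forall x, x <> a -> x <> b -> phi x = 0%E) ->
  (\int[@lebesgue_measure R]_x phi x = 0)%E.
Proof.
move=> phi0 phiab; apply/eqP; rewrite eq_le integral_ge0 ?andbT//.
pose N : set (measurableTypeR R) := [set a; b].
have mN : measurable N by apply: measurableU; exact: measurable_set1.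
have N0 : (@lebesgue_measure R N = 0)%E.
  by apply: countable_lebesgue_measure0; apply: finite_set_countable; exact: finite_set2.
apply: (@le_trans _ _ (\int[@lebesgue_measure R]_x (+oo * (\1_N x)%:E))%E).
  apply: ge0_le_integral_nomeas => // x; rewrite indicE.
  have [Nx|Nx] := pselect (N x); first by rewrite mem_set// mule1 leey.
  rewrite memNset// mule0 phiab//.
  - by move=> xa; apply: Nx; left.
  - by move=> xb; apply: Nx; right.
rewrite ge0_integralZl//; last exact/measurable_EFinP.
by rewrite integral_indic// setIT [X in (_ * X)%E]N0 mule0.
Qed.

(* Over an interior point of the projection of K the slice of the boundary is
   contained in the boundary of the slice; only the (at most two) end points of
   the projection remain. *)
Lemma convset_boundary_null n (K : set 'rV[R]_n) : convset K ->
  iindic (closure K `\` K°) = 0%E.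
Proof.
elim: n K => [|n IH] K cK.
  (* The space has a single point, so a nonempty [K] is its own interior. *)
  rewrite /iindic /=; case: ifPn => // /asboolP[/closureP_rV /(_ 1 ltr01)[y Ky _]].
  case; apply/near_rV; exists 1 => // z _.
  by rewrite (_ : z = y)//; apply/rowP => -[].
rewrite /iindic /=.
pose good x := exists a b va vb, [/\ a < x, x < b, K (cons_rV a va) & K (cons_rV b vb)].
pose E := [set x | ~ good x /\ exists v, closure K (cons_rV x v)].
have ge0 x : (0 <= iint (fun v : 'rV[R]_n =>
    if `[< (closure K `\` K°) (cons_rV x v) >] then 1 else 0))%E.
  by apply: iint_ge0 => v; case: ifP.
have goodP x : good x -> (iint (fun v : 'rV[R]_n =>
    if `[< (closure K `\` K°) (cons_rV x v) >] then 1 else 0) = 0)%E.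
  move=> [a [b [va [vb [ax xb Ka Kb]]]]].
  pose Kx := [set v | K (cons_rV x v)].
  have cKx : convset Kx.
    move=> u v t Ku Kv t01; rewrite /Kx /=.
    rewrite (_ : x = (1 - t) * x + t * x); last by ring.
    by rewrite -cons_rV_mix; exact: cK.
  have anx : a != x by rewrite lt_eqF.
  have bnx : b != x by rewrite gt_eqF.
  (* With points of [K] over both sides of [x], each [y] is on the side of one and opposite to the
     other, so both slice lemmas apply to it. *)
  have sgn y : (0 <= (y - x) / (a - x) /\ (y - x) / (b - x) <= 0) \/
      (0 <= (y - x) / (b - x) /\ (y - x) / (a - x) <= 0).
    have ai : (a - x)^-1 <= 0 by rewrite invr_le0 subr_le0 ltW.
    have bi : 0 <= (b - x)^-1 by rewrite invr_ge0 subr_ge0 ltW.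
    by case: (leP y x) => yx; [left|right]; split; nra.
  apply/eqP; rewrite eq_le ge0 andbT -[leRHS](IH Kx cKx).
  apply: iint_le => v; first by case: ifP.
  case: ifPn => [/asboolP[clv niv]|_]; last by case: ifP.
  rewrite asboolT//; split.
    apply/closureP_rV => e e0.
    have [e1 e10 H1] := closure_slice cK v anx Ka e0.
    have [e2 e20 H2] := closure_slice cK v bnx Kb e0.
    have e120 : 0 < Num.min e1 e2 by rewrite lt_min e10.
    have [y Ky /cons_rV_near[x' [v' [yE]]]] := (closureP_rV _ _).1 clv _ e120.
    rewrite lt_min => /andP[x1 x2] v12.
    have v1 i : `|v' ord0 i - v ord0 i| < e1 by have := v12 i; rewrite lt_min => /andP[].
    have v2 i : `|v' ord0 i - v ord0 i| < e2 by have := v12 i; rewrite lt_min => /andP[].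
    rewrite yE in Ky.
    case: (sgn x') => -[s1 s2].
      by have [u Ku uv] := H2 x' v' s2 x2 v2 Ky; exists u.
    by have [u Ku uv] := H1 x' v' s2 x1 v1 Ky; exists u.
  move=> /near_rV[r r0 Kr]; apply: niv; apply/near_rV.
  have [e1 e10 H1] := interior_slice cK anx Ka r0 Kr.
  have [e2 e20 H2] := interior_slice cK bnx Kb r0 Kr.
  exists (Num.min e1 e2) => [|y /cons_rV_near[x' [v' [->]]]]; first by rewrite lt_min e10.
  rewrite lt_min => /andP[x1 x2] v12.
  have v1 i : `|v' ord0 i - v ord0 i| < e1 by have := v12 i; rewrite lt_min => /andP[].
  have v2 i : `|v' ord0 i - v ord0 i| < e2 by have := v12 i; rewrite lt_min => /andP[].
  by case: (sgn x') => -[s1 s2]; [exact: H1|exact: H2].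
(* Points of [K] near the outer two project to either side of the middle one, which is therefore
   good; hence [E] has at most two elements. *)
have E3 x1 x2 x3 : E x1 -> E x2 -> E x3 -> x1 < x2 -> x2 < x3 -> False.
  move=> [_ [v1 c1]] [ng _] [_ [v3 c3]] x12 x23; apply: ng.
  have e1 : 0 < x2 - x1 by rewrite subr_gt0.
  have e3 : 0 < x3 - x2 by rewrite subr_gt0.
  have [y1 K1 /cons_rV_near[a [va [y1E ha _]]]] := (closureP_rV _ _).1 c1 _ e1.
  have [y3 K3 /cons_rV_near[b [vb [y3E hb _]]]] := (closureP_rV _ _).1 c3 _ e3.
  exists a, b, va, vb; rewrite -y1E -y3E; split => //.
    by have := le_lt_trans (ler_norm _) ha; rewrite ltrBlDr subrK.
  rewrite distrC in hb; have := le_lt_trans (ler_norm _) hb; lra.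
have offE x : ~ E x -> (iint (fun v : 'rV[R]_n =>
    if `[< (closure K `\` K°) (cons_rV x v) >] then 1 else 0) = 0)%E.
  move=> nE; have [/goodP//|ng] := pselect (good x).
  rewrite (_ : (fun v => _) = (fun=> 0%:E * 0)%E).
    by rewrite (@iintZ R n (fun=> 0%E) 0)// mul0e.
  apply/funext => v; rewrite mul0e; case: ifPn => // /asboolP[cv _]; exfalso.
  by apply: nE; split => //; exists v.
have [a [b Eab]] : exists a b, forall x, E x -> x = a \/ x = b.
  have [[a Ea]|noE] := pselect (exists a, E a); last first.
    by exists 0, 0 => x Ex; exfalso; apply: noE; exists x.
  have [[b [Eb ab]]|nb] := pselect (exists b, E b /\ b <> a); last first.
    by exists a, a => x Ex; left; apply: contrapT => xa; apply: nb; exists x.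
  exists a, b => x Ex; case: (ltgtP x a) => [xa|ax|->]; [right| right|by left];
    (case: (ltgtP x b) => [xb|bx|//]; exfalso);
    case: (ltgtP a b) => [ab'|ba'|/esym//].
  - exact: (E3 _ _ _ Ex Ea Eb).
  - exact: (E3 _ _ _ Ex Eb Ea).
  - lra.
  - exact: (E3 _ _ _ Eb Ex Ea).
  - exact: (E3 _ _ _ Ea Ex Eb).
  - lra.
  - exact: (E3 _ _ _ Ea Eb Ex).
  - exact: (E3 _ _ _ Eb Ea Ex).
apply: (integral_off_pair (a := a) (b := b)) => // x xa xb.
by apply: offE => Ex; have [] := Eab x Ex.
Qed.

End convex_boundary.

(** * The upper semicontinuous envelope of a log-concave function *)

Section usc_envelope.
Variables (R : realType) (n : nat) (g : 'rV[R]_n -> R) (X : set 'rV[R]_n).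
Hypothesis lcg : log_concave g.
Hypothesis Xg : (0 < lint X (fun y => (g y)%:E))%E.

Definition superlevel (t : R) : set 'rV[R]_n := [set y | t < g y].

Lemma powR_geo (a b t : R) : 0 < a -> 0 < b -> 0 < a `^ (1 - t) * b `^ t.
Proof. by move=> a0 b0; rewrite mulr_gt0// powR_gt0. Qed.

Lemma powR_self (a t : R) : 0 < a -> a `^ (1 - t) * a `^ t = a.
Proof.
by move=> a0; rewrite -powRD ?subrK ?powRr1 ?ltW// gt_eqF ?implybT.
Qed.

Lemma convset_superlevel t : 0 <= t -> convset (superlevel t).
Proof.
move=> t0 x y s tx ty s01; rewrite /superlevel/= in tx ty *.
have [_ /(_ x y s s01)] := lcg; apply: lt_le_trans.
pose m := Num.min (g x) (g y).
have tm : t < m by rewrite lt_min tx.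
have m0 : 0 < m by apply: le_lt_trans tm.
apply: (lt_le_trans tm); rewrite -[leLHS](powR_self s m0).
have /andP[s0 s1] := s01.
apply: ler_pM; rewrite ?powR_ge0//; apply: ge0_ler_powR; rewrite ?nnegrE ?ge_min ?lexx ?orbT//;
  by [lra | exact: ltW | apply: ltW; apply: le_lt_trans tx | apply: ltW; apply: le_lt_trans ty].
Qed.

(** Otherwise each superlevel set of height 1/(k+1) would be contained in its own boundary, which is
    null by convexity; then [g] would vanish off a null set and have integral 0. *)
Lemma superlevel_ball : exists (z : 'rV[R]_n) (r q : R), [/\ 0 < r, 0 < q &
  forall y : 'rV[R]_n, (forall i, `|y ord0 i - z ord0 i| < r) -> q < g y].
Proof.
apply: contrapT => H.
pose N := \bigcup_k (closure (superlevel k.+1%:R^-1) `\` (superlevel k.+1%:R^-1)°).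
have N0 : iindic N = 0%E.
  apply: iindic_bigcup => k; first exact: boundary_borel.
  by apply: convset_boundary_null; apply: convset_superlevel.
have mN : measurable (N : set (borel_rV R n)) by apply: bigcup_measurable => k _; exact: boundary_borel.
have g0 y : 0 <= g y by have [] := lcg.
suff E : lint X (fun y => (g y)%:E) = 0%E by have := Xg; rewrite E ltxx.
rewrite /lint (@iint_off_null R n N _ (fun=> 0%:E * 0)%E)//.
- by rewrite (@iintZ R n (fun=> 0%E) 0)// mul0e.
- by move=> x; case: ifP; rewrite // lee_fin.
- by move=> x; rewrite mul0e.
move=> y Ny; rewrite mul0e; case: ifP => // _; congr EFin; apply/eqP.
rewrite eq_le g0 andbT leNgt; apply/negP => gy; apply: Ny.
have [k ke] : exists k : nat, k.+1%:R^-1 < g y.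
  by exists (Num.truncn (g y)^-1); rewrite invf_plt ?posrE//; exact: truncnS_gt.
exists k => //; split; first exact: subset_closure.
move=> /near_rV[r r0 kr]; apply: H; by exists y, r, k.+1%:R^-1; split => //.
Qed.

(** The centre [z] of a ball where [g > q] lies between [y'] and a point [w] of that ball, with a
    weight [t] independent of [y']. A very large [g y'] would then force [g z] to be too large. This
    bound makes the supremum of the envelope a genuine one. *)
Lemma log_concave_locally_bounded (y : 'rV[R]_n) : exists B : R, forall y' : 'rV[R]_n,
  (forall i, `|y' ord0 i - y ord0 i| < 1) -> g y' <= B.
Proof.
have [z [r [q [r0 q0 zq]]]] := superlevel_ball.
have [M M0 HM] := coord_bound (y - z).
have M10 : 0 <= M + 1 by rewrite addr_ge0.
have [s /andP[s0 s1] sM] := small_scale r0 M10.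
pose t := s / (1 + s); have s10 : 0 < 1 + s by lra.
have t0 : 0 < t by rewrite divr_gt0.
have t1 : t < 1 by rewrite ltr_pdivrMr//; lra.
exists ((g z / q `^ (1 - t)) `^ t^-1) => y' y'y.
have [lc0 lc] := lcg.
pose w := z - s *: (y' - z).
have gw : q < g w.
  apply: zq => i; rewrite !mxE addrAC subrr add0r normrN normrM gtr0_norm//.
  apply: le_lt_trans sM; rewrite ler_pM2l//.
  have := HM i; rewrite !mxE; have := y'y i => h1 h2.
  rewrite -(subrK (y ord0 i) (y' ord0 i)) -addrA.
  by apply: (le_trans (ler_normD _ _)); lra.
have zE : (1 - t) *: w + t *: y' = z.
  apply/rowP => i; rewrite !mxE /t; move: (z ord0 i) (y' ord0 i) => a b.
  by field; rewrite gt_eqF.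
have := lc w y' t; rewrite zE t0 t1 => /(_ isT) h.
have h2 : g y' `^ t <= g z / q `^ (1 - t).
  rewrite ler_pdivlMr ?powR_gt0//; apply: le_trans h; rewrite mulrC.
  rewrite ler_wpM2r ?powR_ge0//; apply: ge0_ler_powR; rewrite ?nnegrE//; last exact: ltW.
  - lra.
  - exact: ltW.
have tn0 : t != 0 by rewrite gt_eqF.
rewrite -[leLHS]powRr1// -[X in _ `^ X <= _](mulfV tn0) powRrM; apply: ge0_ler_powR => //.
- by rewrite invr_ge0 ltW.
- by rewrite nnegrE powR_ge0.
- by rewrite nnegrE divr_ge0// powR_ge0.
Qed.

(** The supremum of this set is the upper limit of [g] at [y]; the element 0 keeps the set
    nonempty. *)
Definition envelope_set (y : 'rV[R]_n) : set R :=
  [set t | t = 0 \/ (0 < t /\ closure (superlevel t) y)].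

Definition usc_envelope (y : 'rV[R]_n) : R := sup (envelope_set y).

Lemma envelope_has_sup y : has_sup (envelope_set y).
Proof.
split; first by exists 0; left.
have [B HB] := log_concave_locally_bounded y; exists (Num.max 0 B) => t.
case=> [->|[t0 /closureP_rV /(_ 1 ltr01)[y' ty' yy']]]; first by rewrite le_max lexx.
by rewrite le_max (le_trans (ltW ty') (HB _ yy')) orbT.
Qed.

Lemma envelope_ub y t : 0 < t -> closure (superlevel t) y -> t <= usc_envelope y.
Proof.
move=> t0 ty; apply: ub_le_sup; last by right.
by have [] := envelope_has_sup y.
Qed.

Lemma envelope_ge0 y : 0 <= usc_envelope y.
Proof.
by apply: ub_le_sup; [have [] := envelope_has_sup y|left].
Qed.

Lemma lt_envelope y (a : R) : 0 <= a -> a < usc_envelope y ->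
  exists2 t, a < t & closure (superlevel t) y.
Proof.
move=> a0 ay; have [t] := sup_gt (envelope_has_sup y).1 ay.
case=> [->|[t0 ty] at_]; first by rewrite ltNge a0.
by exists t.
Qed.

Lemma closure_superlevel_le y s t : s <= t -> closure (superlevel t) y ->
  closure (superlevel s) y.
Proof.
by move=> st; apply: closure_subset => z; exact: le_lt_trans.
Qed.

Lemma le_envelope y : g y <= usc_envelope y.
Proof.
rewrite leNgt; apply/negP => lt.
pose m := (g y + usc_envelope y) / 2.
have m0 : 0 < m by have := envelope_ge0 y; rewrite /m; lra.
have : m <= usc_envelope y.
  apply: envelope_ub => //; apply: subset_closure; rewrite /superlevel /= /m; lra.
rewrite /m; lra.
Qed.

Lemma measurable_envelope : measurable_fun [set: borel_rV R n] usc_envelope.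
Proof.
apply: (measurability _ (RGenOInfty.measurableE R)) => _ [_ [a ->] <-].
rewrite setTI; have [a0|a0] := leP 0 a; last first.
  rewrite (_ : _ @^-1` _ = setT)//; apply/seteqP; split => // y _ /=.
  by rewrite in_itv/= andbT (lt_le_trans a0)// envelope_ge0.
rewrite (_ : _ @^-1` _ = [set y | exists q : rat,
    ([set y | a < ratr q] `&` closure (superlevel (ratr q))) y]); last first.
  apply/seteqP; split => y /=; rewrite in_itv/= andbT.
    move=> /(lt_envelope a0)[t at_ ty].
    have [q] := rat_in_itvoo at_; rewrite in_itv/= => /andP[aq qt].
    exists q; split => //; exact: closure_superlevel_le (ltW qt) ty.
  move=> [q [aq qy]]; apply: (lt_le_trans aq); apply: envelope_ub => //.
  exact: le_lt_trans aq.
apply: measurable_exists => q; apply: measurableI; last first.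
  by apply: closed_borel; exact: closed_closure.
have [h|h] := boolP (a < ratr q).
  by rewrite (_ : [set _ | _] = setT)//; apply/seteqP; split.
by rewrite (_ : [set _ | _] = set0)//; apply/seteqP; split.
Qed.

(** A rational level strictly between [g y] and the envelope puts [y] in the closure of a superlevel
    set to which it does not belong. *)
Lemma envelope_eq : exists N : set (borel_rV R n), [/\ measurable N, iindic N = 0%E &
  forall y, ~ N y -> usc_envelope y = g y].
Proof.
pose D (q : rat) : set (borel_rV R n) := if 0 <= (ratr q : R)
  then closure (superlevel (ratr q)) `\` (superlevel (ratr q))° else set0.
pose N := \bigcup_k D (odflt 0 (unpickle k)).
have mD q : measurable (D q) by rewrite /D; case: ifP => _ //; exact: boundary_borel.
exists N; split.
- by apply: bigcup_measurable => k _.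
- apply: iindic_bigcup => // k; rewrite /D; case: ifP => [q0|_].
    by apply: convset_boundary_null; exact: convset_superlevel.
  rewrite /iindic (_ : (fun _ => _) = (fun=> 0%:E * 0)%E).
    by rewrite (@iintZ R n (fun=> 0%E) 0)// mul0e.
  by apply/funext => y; rewrite mul0e asboolF.
move=> y Ny; apply/eqP; rewrite eq_le le_envelope andbT leNgt; apply/negP => lt.
apply: Ny; have [q] := rat_in_itvoo lt; rewrite in_itv/= => /andP[gq qy].
have q0 : 0 <= ratr q :> R by have [/(_ y) h _] := lcg; lra.
exists (pickle q) => //; rewrite pickleK/= /D q0; split.
  by have [t qt ty] := lt_envelope q0 qy; exact: closure_superlevel_le (ltW qt) ty.
by move=> /interior_subset; rewrite /superlevel /= ltNge ltW.
Qed.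

(** Scaling both values by [l < 1] scales their geometric mean by [l] and brings them strictly below
    the envelope. Points near [x] and [y] where [g] exceeds the scaled values then exist and can be
    combined. *)
Lemma log_concave_envelope : log_concave usc_envelope.
Proof.
split=> [y|x y t t01]; first exact: envelope_ge0.
have /andP[t0 t1] := t01.
have [x0|] := ltP 0 (usc_envelope x); last first.
  move=> x0; have -> : usc_envelope x = 0 by apply/le_anti; rewrite x0 envelope_ge0.
  by rewrite powR0 ?mul0r ?envelope_ge0// gt_eqF// subr_gt0.
have [y0|] := ltP 0 (usc_envelope y); last first.
  move=> y0; have -> : usc_envelope y = 0 by apply/le_anti; rewrite y0 envelope_ge0.
  by rewrite (@powR0 _ t) ?mulr0 ?envelope_ge0// gt_eqF.
set P := _ * _; have P0 : 0 < P by exact: powR_geo.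
set Gm := usc_envelope _; rewrite leNgt; apply/negP => lt.
(* Any [l < 1] with [Gm < l * P] will do; the entry 1/2 makes positivity immediate. *)
pose l := Num.max (2^-1) (((Gm + P) / 2) / P).
have Gm0 : 0 <= Gm by exact: envelope_ge0.
have l0 : 0 < l by rewrite lt_max invr_gt0 ltr0n.
have l1 : l < 1.
  rewrite gt_max; apply/andP; split; first by lra.
  by rewrite ltr_pdivrMr//; lra.
have lP : Gm < l * P.
  apply: (@lt_le_trans _ _ ((Gm + P) / 2)); first lra.
  by rewrite -ler_pdivrMr// le_max lexx orbT.
suff : l * P <= Gm by rewrite leNgt lP.
pose a := l * usc_envelope x; pose b := l * usc_envelope y.
have a0 : 0 < a by rewrite mulr_gt0.
have b0 : 0 < b by rewrite mulr_gt0.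
have ax : a < usc_envelope x by rewrite /a gtr_pMl.
have bY : b < usc_envelope y by rewrite /b gtr_pMl.
have -> : l * P = a `^ (1 - t) * b `^ t.
  by rewrite /a /b !powRM ?ltW// mulrACA powR_self.
apply: envelope_ub; first exact: powR_geo.
have [a' aa' ca] := lt_envelope (ltW a0) ax; have {}ca := closure_superlevel_le (ltW aa') ca.
have [b' bb' cb] := lt_envelope (ltW b0) bY; have {}cb := closure_superlevel_le (ltW bb') cb.
apply/closureP_rV => e e0.
have [x' gx' xx'] := (closureP_rV _ _).1 ca e e0.
have [y' gy' yy'] := (closureP_rV _ _).1 cb e e0.
exists ((1 - t) *: x' + t *: y').
  rewrite /superlevel /=; have [_ /(_ x' y' t t01)] := lcg; apply: lt_le_trans.
  rewrite /superlevel /= in gx' gy'.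
  apply: ltr_pM; rewrite ?powR_ge0//; apply: gt0_ltr_powR; rewrite ?nnegrE//; try lra;
    by apply: ltW => //; apply: lt_trans gx' || apply: lt_trans gy'.
move=> i; rewrite !mxE; have := xx' i; have := yy' i.
move: (x' ord0 i) (y' ord0 i) (x ord0 i) (y ord0 i) => p q p' q' h1 h2.
have -> : (1 - t) * p + t * q - ((1 - t) * p' + t * q') =
  (1 - t) * (p - p') + t * (q - q') by ring.
apply: (le_lt_trans (ler_normD _ _)); rewrite !normrM (gtr0_norm t0) gtr0_norm; last lra.
by nra.
Qed.

End usc_envelope.

(** * The Orlicz functional *)

Section measurability.
Variable R : realType.

Lemma borel_leb_measurable n (g : 'rV[R]_n -> R) :
  measurable_fun [set: borel_rV R n] g -> leb_measurable_fun g.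
Proof.
move=> mg; exists g; split.
  by move=> B mB; have := mg measurableT B mB; rewrite setTI.
exists set0; split; first exact: (@measurable0 _ (borel_rV R n)).
split; first by move=> x.
rewrite (_ : (fun _ => _) = (fun=> 0%:E * 0)%E).
  by rewrite (@iintZ R n (fun=> 0%E) 0)// mul0e.
by apply/funext => y; rewrite mul0e asboolF.
Qed.

(** A supremum of affine functions is lower semicontinuous: the sets where it exceeds a level are
    open. *)
Lemma measurable_legendre n (psi : 'rV[R]_n -> \bar R) :
  (forall x, psi x != -oo%E) -> measurable_fun [set: borel_rV R n] (legendre psi).
Proof.
move=> psiNy; apply: (measurability _ (ErealGenOInfty.measurableE R)).
move=> _ [_ [a ->] <-]; rewrite setTI; apply: open_borel.
apply/openP_rV => y Uy; apply: (near_rV y _).1; move: Uy.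
rewrite /= in_itv/= andbT => /ereal_sup_gt[_ [x _ <-]].
have := psiNy x; case psix: (psi x) => [r| |] // _.
rewrite -EFinB lte_fin => ay.
have c : (fun z => dotv x z - r) @ y --> dotv x y - r.
  apply: (@cvgB _ _ _ (nbhs y)); last exact: cvg_cst.
  by apply: (@cvg_dotv R n _ (nbhs y)) => i; [exact: cvg_cst|exact: cvg_coord].
have : \forall z \near y, a < dotv x z - r.
  apply: (c [set b : R | a < b]); apply: open_nbhs_nbhs; split; first exact: open_gt.
  by [].
apply: filterS => z az /=; rewrite in_itv/= andbT.
apply: (@lt_le_trans _ _ ((dotv x z)%:E - psi x)%E); first by rewrite psix -EFinB lte_fin.
by apply: ereal_sup_ubound; exists x.
Qed.

Lemma measurable_F2_comp n (psi : 'rV[R]_n -> \bar R) (F2 : R -> R) :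
  (forall x, psi x != -oo%E) -> measurable_fun setT F2 ->
  measurable_fun [set: borel_rV R n] (F2_comp F2 (legendre psi)).
Proof.
move=> psiNy mF2; have ml := measurable_legendre psiNy.
apply: measurable_fun_ifT => //.
  apply: (measurable_fun_bool true); rewrite setTI.
  rewrite (_ : _ @^-1` _ = legendre psi @^-1` (~` ([set -oo%E] `|` [set +oo%E]))).
    rewrite -[X in measurable X]setTI; apply: ml => //; apply: measurableC.
    by apply: measurableU; exact: emeasurable_set1.
  apply/seteqP; split=> y /=; first by move=> fy [] yE; rewrite yE in fy.
  by move=> H; rewrite fin_numE; apply/andP; split; apply/eqP => yE; apply: H; [left|right].
apply: (measurableT_comp mF2).
exact: (measurableT_comp (fine_measurable measurableT) ml).
Qed.

Lemma measurable_pos_cont (k : R -> R) : pos_cont k ->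
  measurable_fun setT (fun t : R => if 0 < t then k t else 0).
Proof.
move=> [_ ck]; have oD : measurable [set t : R | 0 < t].
  by apply: open_measurable; exact: open_gt.
have := subspace_continuous_measurable_fun oD ck.
move=> /(measurable_restrictT _ oD); apply: eq_measurable_fun => t _.
rewrite /patch; case: ifPn => [|].
  by rewrite inE /= => ->.
by rewrite notin_setE /= => /negP/negbTE ->.
Qed.

Lemma pos_cont_inv : pos_cont (@GRing.inv R).
Proof.
split=> [t|]; first by rewrite invr_gt0.
apply: continuous_in_subspaceT => t; rewrite inE /= => t0.
by apply: inv_continuous; rewrite gt_eqF.
Qed.

End measurability.

(** * Evaluation, comparison and Borel approximation of V *)

Section orlicz_functional.
Variables (R : realType) (n : nat) (F1 F2 : R -> R) (psi : 'rV[R]_n -> \bar R).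
Hypotheses (mF1 : measurable_fun setT F1) (mF2 : measurable_fun setT F2).
Hypotheses (F1_gt0 : forall t, 0 < F1 t) (F2_gt0 : forall t, 0 < F2 t).
Hypothesis psiC : in_C psi.
Hypothesis IF1 : (0 < IF psi F1 < +oo)%E.
Hypothesis IF2 : (0 < IF (legendre psi) F2 < +oo)%E.

Local Notation psis := (legendre psi).
Local Notation X := (Xset psi).
Local Notation Z := (Num.sqrt (2 * pi) ^+ n : R).

Definition ratio (g : 'rV[R]_n -> R) x : R :=
  normalize psi g (grad psi x) / F2 (dotv x (grad psi x) - fine (psi x)).

Definition V (k : R -> R) (g : 'rV[R]_n -> R) : \bar R :=
  Vorl k F1 F2 psi (normalize psi g).

Lemma VE k g : V k g = lint X (fun x => (k (ratio g x) * F1 (fine (psi x)))%:E).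
Proof. by []. Qed.

Lemma Z_gt0 : 0 < Z.
Proof. by rewrite exprn_gt0// sqrtr_gt0 mulr_gt0// pi_gt0. Qed.

(** [grad] is chosen with no regard to invertibility of the Hessian; uniqueness, through [gradl],
    identifies it with the gradient that comes with an invertible one. *)
Lemma grad_alex_unit x : X x -> exists2 A, alex psi x (grad psi x) A & A \in unitmx.
Proof.
move=> Xx; have [_ [p [A [pA Au]]]] := Xx.
by exists A => //; rewrite grad_gradl// (alex_gradl pA).
Qed.

Lemma grad_Xset x : X x -> Xset psis (grad psi x).
Proof.
move=> /grad_alex_unit[A pA Au]; split.
  by rewrite (legendre_alex psiC pA) ltry.
exists x, (invmx A); split; first exact: alex_legendre.
by rewrite unitmx_inv.
Qed.

Lemma legendre_grad x : X x ->
  psis (grad psi x) = (dotv x (grad psi x) - fine (psi x))%:E.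
Proof. by move=> /grad_alex_unit[A pA Au]; rewrite (legendre_alex psiC pA). Qed.

Lemma F2_comp_grad x : X x ->
  F2_comp F2 psis (grad psi x) = F2 (dotv x (grad psi x) - fine (psi x)).
Proof. by move=> Xx; rewrite /F2_comp legendre_grad. Qed.

Lemma Fplus_Ig g : Fplus psis g -> 0 < fine (Ig psis g) /\ Ig psis g \is a fin_num.
Proof.
move=> [_ _ /andP[I0 Ioo]]; split; first by rewrite fine_gt0// I0.
by rewrite ge0_fin_numE// ltW.
Qed.

Lemma ratio_gt0 g x : Fplus psis g -> X x -> 0 < ratio g x.
Proof.
move=> gF Xx; have [I0 _] := Fplus_Ig gF; have [_ gX _] := gF.
rewrite /ratio /normalize !divr_gt0// mulr_gt0 ?Z_gt0//.
by apply: gX; exact: grad_Xset.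
Qed.

Lemma measurable_on_F1 (c : R) : measurable_on X (fun x => (c * F1 (fine (psi x)))%:E).
Proof.
rewrite /measurable_on (_ : (fun _ => _) =
    (fun x => if `[< X x >] then (c * F1 (psi0 psi x))%:E else 0%E)); last first.
  by apply/funext => x; case: ifPn => // /asboolP Xx; rewrite fine_psi0.
apply: measurable_asbool_if => //; first exact: measurable_Xset.
apply/measurable_EFinP; apply: measurable_funM => //.
exact: (measurableT_comp mF1 (measurable_psi0 psiC)).
Qed.

Lemma measurable_on_V k g : pos_cont k -> Fplus psis g -> measurable_fun [set: borel_rV R n] g ->
  measurable_on X (fun x => (k (ratio g x) * F1 (fine (psi x)))%:E).
Proof.
move=> kp gF mg.
pose rt (x : borel_rV R n) : R := Z * g (gradl psi x) / fine (Ig psis g) /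
  F2 (dotv x (gradl psi x) - psi0 psi x).
have mgr : measurable_fun [set: borel_rV R n] (fun x : borel_rV R n => g (gradl psi x)).
  exact: (measurableT_comp mg (measurable_gradl psiC)).
have mdot : measurable_fun [set: borel_rV R n] (fun x : borel_rV R n => dotv x (gradl psi x)).
  apply: measurable_sum => i; apply: measurable_funM; first exact: measurable_coord.
  exact: (measurableT_comp (@measurable_coord R n i) (measurable_gradl psiC)).
have mF2r : measurable_fun [set: borel_rV R n]
    (fun x : borel_rV R n => (F2 (dotv x (gradl psi x) - psi0 psi x))^-1).
  rewrite (_ : (fun _ => _) = (fun t : R => if 0 < t then t^-1 else 0) \o
      (fun x : borel_rV R n => F2 (dotv x (gradl psi x) - psi0 psi x))); last first.
    by apply/funext => x /=; rewrite F2_gt0.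
  apply: (measurableT_comp (measurable_pos_cont (@pos_cont_inv R))).
  apply: (measurableT_comp mF2); apply: measurable_funB => //.
  exact: measurable_psi0.
have mrt : measurable_fun [set: borel_rV R n] rt.
  by apply: measurable_funM => //; apply: measurable_funM => //; apply: measurable_funM.
(* [k] is continuous only on the positive reals, so it is cut off to 0 elsewhere; on [X] the ratio
   is positive and nothing changes. *)
rewrite /measurable_on (_ : (fun _ => _) = (fun x => if `[< X x >] then
    ((if 0 < rt x then k (rt x) else 0) * F1 (psi0 psi x))%:E else 0%E)); last first.
  apply/funext => x; case: ifPn => // /asboolP Xx; rewrite fine_psi0//.
  have <- : ratio g x = rt x by rewrite /ratio /normalize /rt grad_gradl// fine_psi0.
  by rewrite ratio_gt0.
apply: measurable_asbool_if => //; first exact: measurable_Xset.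
apply/measurable_EFinP; apply: measurable_funM; last first.
  exact: (measurableT_comp mF1 (measurable_psi0 psiC)).
exact: (measurableT_comp (measurable_pos_cont kp) mrt).
Qed.

Lemma lint_cF1 (c : R) : 0 <= c ->
  lint X (fun x => (c * F1 (fine (psi x)))%:E) = (c%:E * IF psi F1)%E.
Proof.
move=> c0; rewrite /IF -lintZ//; last by move=> x _; rewrite lee_fin ltW.
Qed.

Lemma V_ge0 k g : pos_cont k -> Fplus psis g -> (0 <= V k g)%E.
Proof.
move=> [k0 _] gF; apply: lint_ge0 => x Xx; rewrite lee_fin mulr_ge0 ?(ltW (F1_gt0 _))//.
by rewrite ltW// k0// ratio_gt0.
Qed.

Lemma lintZV (c : R) k g : pos_cont k -> Fplus psis g -> 0 <= c ->
  lint X (fun x => (c * (k (ratio g x) * F1 (fine (psi x))))%:E) = (c%:E * V k g)%E.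
Proof.
move=> [k0 _] gF c0; rewrite VE -lintZ// => x Xx; rewrite lee_fin.
by rewrite mulr_ge0 ?(ltW (F1_gt0 _))// ltW// k0// ratio_gt0.
Qed.

Lemma lint_affine (a c : R) k g : pos_cont k -> Fplus psis g -> 0 <= a -> 0 <= c ->
  lint X (fun x => ((a + c * k (ratio g x)) * F1 (fine (psi x)))%:E) =
  (a%:E * IF psi F1 + c%:E * V k g)%E.
Proof.
move=> kp gF a0 c0; rewrite -lint_cF1// -lintZV// -lintD.
- by apply: eq_lint => x _; rewrite -EFinD mulrDl mulrA.
- exact: measurable_on_F1.
- by move=> x _; rewrite lee_fin mulr_ge0// ltW.
- move=> x Xx; rewrite lee_fin !mulr_ge0 ?(ltW (F1_gt0 _))//.
  by have [k0 _] := kp; rewrite ltW// k0// ratio_gt0.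
Qed.

(** Coefficients stay nonnegative on both sides: V may be infinite and additivity holds for
    nonnegative integrands, so an affine bound is rearranged before it is integrated. *)
Lemma V_affine_le (a1 c1 a2 c2 : R) k1 k2 g : pos_cont k1 -> pos_cont k2 ->
  Fplus psis g -> 0 <= a1 -> 0 <= c1 -> 0 <= a2 -> 0 <= c2 ->
  (forall t, 0 < t -> a1 + c1 * k1 t <= a2 + c2 * k2 t) ->
  (a1%:E * IF psi F1 + c1%:E * V k1 g <= a2%:E * IF psi F1 + c2%:E * V k2 g)%E.
Proof.
move=> kp1 kp2 gF a10 c10 a20 c20 H; rewrite -!lint_affine//.
have [k0 _] := kp1.
apply: lint_le => x Xx; rewrite lee_fin.
  by rewrite mulr_ge0 ?(ltW (F1_gt0 _))// addr_ge0// mulr_ge0// ltW// k0// ratio_gt0.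
by rewrite ler_pM2r//; apply: H; exact: ratio_gt0.
Qed.

Lemma V_sum_ge (b c : R) k1 k2 g : pos_cont k1 -> pos_cont k2 ->
  Fplus psis g -> measurable_fun [set: borel_rV R n] g -> 0 <= b -> 0 <= c ->
  (forall t, 0 < t -> b <= k1 t + c * k2 t) ->
  (b%:E * IF psi F1 <= V k1 g + c%:E * V k2 g)%E.
Proof.
move=> kp1 kp2 gF mg b0 c0 H; rewrite -lint_cF1// -lintZV// VE -lintD.
- apply: lint_le => x Xx; first by rewrite lee_fin mulr_ge0// ltW.
  by rewrite -EFinD lee_fin mulrA -mulrDl ler_pM2r//; apply: H; exact: ratio_gt0.
- exact: measurable_on_V.
- move=> x Xx; rewrite lee_fin mulr_ge0 ?(ltW (F1_gt0 _))//.
  by have [k0 _] := kp1; rewrite ltW// k0// ratio_gt0.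
- move=> x Xx; rewrite lee_fin !mulr_ge0 ?(ltW (F1_gt0 _))//.
  by have [k0 _] := kp2; rewrite ltW// k0// ratio_gt0.
Qed.

Lemma Xset_fin x : Xset psis x -> psis x \is a fin_num.
Proof. by move=> [_ [p [A [[_ []]]]]]. Qed.

Lemma F2_comp_gt0 y : Xset psis y -> 0 < F2_comp F2 psis y.
Proof. by move=> /Xset_fin fy; rewrite /F2_comp fy. Qed.

Lemma Fplus_F2_comp : Fplus psis (F2_comp F2 psis).
Proof.
have [psiNy _ _] := psiC; split.
- by apply: borel_leb_measurable; exact: measurable_F2_comp.
- exact: F2_comp_gt0.
- rewrite /Ig (eq_lint (g := fun y => (F2 (fine (psis y)))%:E)) => [|y /Xset_fin fy].
    exact: IF2.
  by rewrite /F2_comp fy.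
Qed.

Lemma V_test : exists2 c : R, 0 < c & forall k, pos_cont k ->
  V k (F2_comp F2 psis) = ((k c)%:E * IF psi F1)%E.
Proof.
have [I0 _] := Fplus_Ig Fplus_F2_comp.
exists (Z / fine (Ig psis (F2_comp F2 psis))); first by rewrite divr_gt0// Z_gt0.
move=> k [k0 _]; rewrite -lint_cF1; last by rewrite ltW// k0// divr_gt0// Z_gt0.
rewrite VE; apply: eq_lint => x Xx; congr (k _ * _)%:E.
rewrite /ratio /normalize F2_comp_grad//; field.
by rewrite !gt_eqF.
Qed.

Lemma Ig_off_null g g' (N : set (borel_rV R n)) : measurable N -> iindic N = 0%E ->
  (forall y, Xset psis y -> 0 < g y) -> (forall y, Xset psis y -> 0 < g' y) ->
  (forall y, ~ N y -> g y = g' y) -> Ig psis g = Ig psis g'.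
Proof.
move=> mN N0 g0 g0' gg'; apply: (iint_off_null mN N0).
- by move=> y; case: ifPn => // /asboolP Xy; rewrite lee_fin ltW// g0.
- by move=> y; case: ifPn => // /asboolP Xy; rewrite lee_fin ltW// g0'.
- by move=> y /gg' ->.
Qed.

(** On the null Borel set [B] the ratio is set to a number [M] where [k] is within [e] of its
    infimum. So [k] of the ratio grows by at most [e] at every point, however many points have their
    gradient in [B]. *)
Lemma V_borel_approx k g (e : R) : pos_cont k -> Fplus psis g -> 0 < e ->
  exists g', [/\ Fplus psis g', measurable_fun [set: borel_rV R n] g' &
    (V k g' <= V k g + e%:E * IF psi F1)%E].
Proof.
move=> kp gF e0; have [k0 _] := kp; have [I0 fI] := Fplus_Ig gF.
have [[g1 [mg1 [B [mB [gB B0]]]]] gX Ig0] := gF.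
have [psiNy _ _] := psiC.
pose S := [set k t | t in [set t : R | 0 < t]].
have Si : has_inf S.
  split; first by exists (k 1), 1 => //=.
  by exists 0 => _ [t /= t0 <-]; rewrite ltW// k0.
have [_ [M /= M0 <-] Me] := inf_adherent e0 Si.
have kM t : 0 < t -> k M <= e + k t.
  move=> t0; have : inf S <= k t by apply: ge_inf; [exact: Si.2|exists t].
  lra.
(* The factor undoes the normalisation, so that the ratio of [g'] is exactly [M] on [B]. *)
pose m := M * fine (Ig psis g) / Z.
have m0 : 0 < m by rewrite divr_gt0 ?mulr_gt0// Z_gt0.
pose g' y := if `[< B y >] then m * F2_comp F2 psis y else g1 y.
have gE y : ~ B y -> g y = g1 y by move=> nB; apply: contrapT => gg; apply: nB; exact: gB.
have mB' : measurable (B : set (borel_rV R n)) by exact: mB.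
have mg' : measurable_fun [set: borel_rV R n] g'.
  apply: measurable_fun_ifT.
  - apply: (measurable_fun_bool true); rewrite setTI.
    by congr measurable : mB'; apply/seteqP; split=> x /asboolP.
  - by apply: measurable_funM => //; exact: measurable_F2_comp.
  - by move=> _ D mD; rewrite setTI; exact: mg1.
have g'X y : Xset psis y -> 0 < g' y.
  move=> Xy; rewrite /g'; case: ifPn => [_|/asboolPn nB].
    by rewrite mulr_gt0// F2_comp_gt0.
  by rewrite -gE//; exact: gX.
have IgE : Ig psis g' = Ig psis g.
  apply: (Ig_off_null mB' B0) => // y nB; rewrite /g' asboolF// gE//.
have g'F : Fplus psis g' by split=> //; [exact: borel_leb_measurable|rewrite IgE].
exists g'; split => //.
rewrite addeC -[X in (_ + X)%E]mul1e -lint_affine//; last exact: ltW.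
apply: lint_le => x Xx; rewrite lee_fin.
  by rewrite mulr_ge0 ?(ltW (F1_gt0 _))// ltW// k0// ratio_gt0.
rewrite ler_pM2r// mul1r; rewrite {1}/ratio /normalize IgE /g'.
case: ifPn => [_|/asboolPn nB].
  rewrite F2_comp_grad// (_ : _ / _ = M).
    by apply: kM; exact: ratio_gt0.
  by rewrite /m; field; rewrite !gt_eqF// Z_gt0.
by rewrite -gE// -[X in k X <= _]/(ratio g x) lerDr ltW.
Qed.

(** The envelope has the same integral as [g] and lies above it, so the ratio can only grow and the
    decreasing [k] can only drop. *)
Lemma V_log_concave_approx k g : pos_cont k ->
  (forall s t, 0 < s -> s < t -> k t < k s) -> Lset psis g ->
  exists g', [/\ Lset psis g', measurable_fun [set: borel_rV R n] g' & (V k g' <= V k g)%E].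
Proof.
move=> [k0 ck] kdec [gF lcg]; have [I0 fI] := Fplus_Ig gF; have [_ gX Ig0] := gF.
have /andP[Igp _] := Ig0.
have mE := measurable_envelope lcg Igp; have leE := le_envelope lcg Igp.
have lcE := log_concave_envelope lcg Igp; have [N [mN N0 NE]] := envelope_eq lcg Igp.
pose g' := usc_envelope g.
have g'X y : Xset psis y -> 0 < g' y by move=> /gX gy; apply: lt_le_trans (leE y).
have IgE : Ig psis g' = Ig psis g by exact: (Ig_off_null mN N0).
have g'F : Fplus psis g' by split=> //; [exact: borel_leb_measurable|rewrite IgE].
exists g'; split => //; rewrite !VE.
apply: lint_le => x Xx; rewrite lee_fin.
  by rewrite mulr_ge0 ?(ltW (F1_gt0 _))// ltW// k0// ratio_gt0.
rewrite ler_pM2r//.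
have : ratio g x <= ratio g' x.
  rewrite /ratio /normalize IgE ler_pM2r ?invr_gt0// ler_pM2r ?invr_gt0//.
  by rewrite ler_pM2l ?Z_gt0// leE.
rewrite le_eqVlt => /predU1P[->//|lt].
by rewrite ltW// kdec// ratio_gt0.
Qed.

End orlicz_functional.

(** * Supporting lines and extrema *)

Section supporting_line.
Variable R : realType.

Lemma pos_cont_inj_monotone (h : R -> R) : pos_cont h ->
  (forall s t, 0 < s -> 0 < t -> h s = h t -> s = t) ->
  (forall s t, 0 < s -> s < t -> h s < h t) \/ (forall s t, 0 < s -> s < t -> h t < h s).
Proof.
move=> [_ ch] hinj.
have itvE : [set t : R | 0 < t] = [set` `]0, +oo[].
  by apply/seteqP; split=> t /=; rewrite in_itv/= andbT.
rewrite itvE in ch.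
have hinj' : {in `]0, +oo[ &, injective h}.
  by move=> s t; rewrite !in_itv/= !andbT => s0 t0; exact: hinj.
have [hm|hm] := itv_continuous_inj_mono ch hinj'; [left|right] => s t s0 st;
  by apply: hm => //; rewrite in_itv/= andbT// (lt_trans s0).
Qed.

(** No value is extreme in the range, so a supporting line exists at each of them. *)
Lemma pos_cont_inj_both_sides (h : R -> R) : pos_cont h ->
  (forall s t, 0 < s -> 0 < t -> h s = h t -> s = t) -> forall t, 0 < t ->
  exists t1 t2, [/\ 0 < t1, 0 < t2, h t1 < h t & h t < h t2].
Proof.
move=> hp hinj t t0; have ht : 0 < t / 2 by rewrite divr_gt0.
have [hm|hm] := pos_cont_inj_monotone hp hinj.
  by exists (t / 2), (2 * t); split; rewrite ?hm//; lra.
by exists (2 * t), (t / 2); split; rewrite ?hm//; lra.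
Qed.

(** The slope is the supremum of the chord slopes to the right of [s], each at most every chord
    slope to the left. *)
Lemma concave_supporting_line (J : set R) (H : R -> R) (a s b : R) :
  concave_on J H -> J a -> J s -> J b -> a < s < b ->
  exists k, forall x, J x -> H x <= H s + k * (x - s).
Proof.
move=> cH Ja Js Jb /andP[as_ sb].
have slopes x y : J x -> J y -> x < s -> s < y ->
    (H y - H s) / (y - s) <= (H s - H x) / (s - x).
  move=> Jx Jy xs sy; have yx : 0 < y - x by lra.
  pose t := (s - x) / (y - x).
  have t01 : 0 <= t <= 1.
    by rewrite divr_ge0 ?ler_pdivrMr//; lra.
  have := cH x y t Jx Jy t01.
  have -> : (1 - t) * x + t * y = s by rewrite /t; field; lra.
  have -> : 1 - t = (y - s) / (y - x) by rewrite /t; field; lra.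
  rewrite /t mulrAC [_ / _ * H y]mulrAC -mulrDl ler_pdivrMr// => h.
  rewrite ler_pdivrMr ?subr_gt0// mulrAC ler_pdivlMr ?subr_gt0//.
  lra.
pose S := [set (H y - H s) / (y - s) | y in [set y | J y /\ s < y]].
have hS : has_sup S.
  split; first by exists ((H b - H s) / (b - s)), b.
  by exists ((H s - H a) / (s - a)) => _ [y [Jy sy] <-]; exact: slopes.
exists (sup S) => x Jx; case: (ltgtP x s) => [xs|sx|->]; last by lra.
- have : sup S <= (H s - H x) / (s - x).
    by apply: ge_sup; [exact: hS.1|move=> _ [y [Jy sy] <-]; exact: slopes].
  rewrite ler_pdivlMr ?subr_gt0//; lra.
- have : (H x - H s) / (x - s) <= sup S by apply: ub_le_sup; [exact: hS.2|exists x].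
  rewrite ler_pdivrMr ?subr_gt0//; lra.
Qed.

End supporting_line.

(** * From a pointwise line to the infimum or supremum over a class [G] *)

Section orlicz_extremum.
Variables (R : realType) (n : nat) (F1 F2 : R -> R) (psi : 'rV[R]_n -> \bar R).
Hypotheses (mF1 : measurable_fun setT F1) (mF2 : measurable_fun setT F2).
Hypotheses (F1_gt0 : forall t, 0 < F1 t) (F2_gt0 : forall t, 0 < F2 t).
Hypothesis psiC : in_C psi.
Variable I : R.
Hypothesis IE : IF psi F1 = I%:E.
Hypothesis I_gt0 : 0 < I.
Local Notation psis := (legendre psi).
Local Notation V := (V F1 F2 psi).
Variable G : set ('rV[R]_n -> R).
Hypothesis GF : G `<=` Fplus psis.

Definition values (k : R -> R) : set (\bar R) := [set V k g | g in G].

Variables (h h1 : R -> R) (s0 H0 k : R).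
Hypotheses (hp : pos_cont h) (hp1 : pos_cont h1).
Hypotheses (s0_gt0 : 0 < s0) (H0_gt0 : 0 < H0) (k_gt0 : 0 < k).

Lemma V_affine_leE (a1 c1 a2 c2 : R) k1 k2 g : pos_cont k1 -> pos_cont k2 ->
  G g -> 0 < a1 -> 0 < c1 -> 0 < a2 -> 0 < c2 ->
  (forall t, 0 < t -> a1 + c1 * k1 t <= a2 + c2 * k2 t) ->
  ((a1 * I)%:E + c1%:E * V k1 g <= (a2 * I)%:E + c2%:E * V k2 g)%E.
Proof.
move=> kp1 kp2 Gg a10 c10 a20 c20 line.
by rewrite !EFinM -IE; apply: V_affine_le => //; [exact: GF|exact: ltW..].
Qed.

Lemma concave_line_V g : G g -> (forall t, 0 < t -> h t <= H0 + k * (h1 t - s0)) ->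
  ((k * s0 * I)%:E + V h g <= (H0 * I)%:E + k%:E * V h1 g)%E.
Proof.
move=> Gg line; rewrite -[V h g]mul1e; apply: V_affine_leE => //; first exact: mulr_gt0.
by move=> t t0; have := line t t0; lra.
Qed.

Lemma convex_line_V g : G g -> (forall t, 0 < t -> H0 + k * (h1 t - s0) <= h t) ->
  ((H0 * I)%:E + k%:E * V h1 g <= (k * s0 * I)%:E + V h g)%E.
Proof.
move=> Gg line; rewrite -[V h g]mul1e; apply: V_affine_leE => //; first exact: mulr_gt0.
by move=> t t0; have := line t t0; lra.
Qed.

Lemma V_G_ge0 j g : pos_cont j -> G g -> (0 <= V j g)%E.
Proof. by move=> jp /GF; exact: V_ge0. Qed.

Lemma inf_concave_le : (forall t, 0 < t -> h t <= H0 + k * (h1 t - s0)) ->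
  ereal_inf (values h1) = (s0 * I)%:E -> (ereal_inf (values h) <= (H0 * I)%:E)%E.
Proof.
move=> line infE; apply/lee_addgt0Pr => e e0.
have e'0 : 0 < e / k by rewrite divr_gt0.
have [] := @lb_ereal_inf_adherent _ (values h1) _ e'0; first by rewrite infE.
move=> _ [g Gg <-]; rewrite infE -EFinD => Vg.
apply: (@le_trans _ _ (V h g)); first by apply: ereal_inf_lbound; exists g.
have := concave_line_V Gg line; have := V_G_ge0 hp1 Gg; move: Vg.
case: (V h1 g) => [r| |]//; rewrite lte_fin => rs _.
case: (V h g) => [w| |]//; last by move=> *; rewrite leNye.
rewrite -!EFinM -!EFinD !lee_fin => hh.
have : k * r < k * (s0 * I + e / k) by rewrite ltr_pM2l.
rewrite mulrDr [k * (e / k)]mulrCA mulfV ?gt_eqF// mulr1; lra.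
Qed.

Lemma sup_concave_le : (forall t, 0 < t -> h t <= H0 + k * (h1 t - s0)) ->
  ereal_sup (values h1) = (s0 * I)%:E -> (ereal_sup (values h) <= (H0 * I)%:E)%E.
Proof.
move=> line supE; apply: ge_ereal_sup => _ [g Gg <-].
have : (V h1 g <= (s0 * I)%:E)%E by rewrite -supE; apply: ereal_sup_ubound; exists g.
have := concave_line_V Gg line; have := V_G_ge0 hp1 Gg.
case: (V h1 g) => [r| |]// _; case: (V h g) => [w| |]//; last by move=> *; rewrite leNye.
rewrite -!EFinM -!EFinD !lee_fin => hh rs.
have : k * r <= k * (s0 * I) by rewrite ler_pM2l.
lra.
Qed.

Lemma inf_convex_ge : (forall t, 0 < t -> H0 + k * (h1 t - s0) <= h t) ->
  ereal_inf (values h1) = (s0 * I)%:E -> ((H0 * I)%:E <= ereal_inf (values h))%E.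
Proof.
move=> line infE; apply: le_ereal_inf_tmp => _ [g Gg <-].
have : ((s0 * I)%:E <= V h1 g)%E by rewrite -infE; apply: ereal_inf_lbound; exists g.
have := convex_line_V Gg line; have := V_G_ge0 hp Gg.
case: (V h g) => [w| |]//; last by move=> *; rewrite leey.
move=> _; case: (V h1 g) => [r| |]//; last first.
  by rewrite gt0_muley ?lte_fin// addey// -EFinD leye_eq.
rewrite -!EFinM -!EFinD !lee_fin => hh rs.
have : k * (s0 * I) <= k * r by rewrite ler_pM2l.
lra.
Qed.

Lemma sup_convex_ge : (forall t, 0 < t -> H0 + k * (h1 t - s0) <= h t) ->
  ereal_sup (values h1) = (s0 * I)%:E -> ((H0 * I)%:E <= ereal_sup (values h))%E.
Proof.
move=> line supE; apply/lee_addgt0Pr => e e0.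
have e'0 : 0 < e / k by rewrite divr_gt0.
have [] := @ub_ereal_sup_adherent _ (values h1) _ e'0; first by rewrite supE.
move=> _ [g Gg <-]; rewrite supE -EFinB => Vg.
apply: (@le_trans _ _ (V h g + e%:E)%E); last first.
  by rewrite leeD2r//; apply: ereal_sup_ubound; exists g.
have := convex_line_V Gg line; have := V_G_ge0 hp Gg; move: Vg.
case: (V h g) => [w| |]//; last by move=> *; rewrite leey.
move=> + _; case: (V h1 g) => [r| |]//; last first.
  by rewrite gt0_muley ?lte_fin// addey// -EFinD leye_eq.
rewrite -!EFinM -!EFinD !lee_fin lte_fin => rs hh.
have : k * (s0 * I - e / k) < k * r by rewrite ltr_pM2l.
rewrite mulrBr [k * (e / k)]mulrCA mulfV ?gt_eqF// mulr1; lra.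
Qed.

Definition borel_approximable (j : R -> R) : Prop := forall g (e : R), G g -> 0 < e ->
  exists g', [/\ G g', measurable_fun [set: borel_rV R n] g' & (V j g' <= V j g + (e * I)%:E)%E].

Lemma decreasing_line_V g : G g -> measurable_fun [set: borel_rV R n] g ->
  (forall t, 0 < t -> H0 + k * s0 <= h t + k * h1 t) ->
  (((H0 + k * s0) * I)%:E <= V h g + k%:E * V h1 g)%E.
Proof.
move=> Gg mg line; rewrite EFinM -IE; apply: V_sum_ge => //; first exact: GF.
- by rewrite ltW// addr_gt0// mulr_gt0.
- exact: ltW.
Qed.

(** Passing to a Borel [g'] needs control of [V h] alone, since the supremum bounds [V h1 g'] for
    every [g'] in [G]. *)
Lemma inf_decreasing_ge : borel_approximable h ->
  (forall t, 0 < t -> H0 + k * s0 <= h t + k * h1 t) ->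
  ereal_sup (values h1) = (s0 * I)%:E -> ((H0 * I)%:E <= ereal_inf (values h))%E.
Proof.
move=> apx line supE; apply: le_ereal_inf_tmp => _ [g Gg <-].
apply/lee_addgt0Pr => e e0; have e'0 : 0 < e / I by rewrite divr_gt0.
have [g' [Gg' mg']] := apx g _ Gg e'0; rewrite divfK ?gt_eqF//.
apply: le_trans.
have : (V h1 g' <= (s0 * I)%:E)%E by rewrite -supE; apply: ereal_sup_ubound; exists g'.
have := decreasing_line_V Gg' mg' line; have := V_G_ge0 hp1 Gg'.
case: (V h1 g') => [r| |]// _; have := V_G_ge0 hp Gg'.
case: (V h g') => [w| |]//; last by move=> *; rewrite leey.
rewrite -!EFinM -!EFinD !lee_fin => _ hh rs.
have : k * r <= k * (s0 * I) by rewrite ler_pM2l.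
lra.
Qed.

Lemma sup_decreasing_ge : borel_approximable h1 ->
  (forall t, 0 < t -> H0 + k * s0 <= h t + k * h1 t) ->
  ereal_inf (values h1) = (s0 * I)%:E -> ((H0 * I)%:E <= ereal_sup (values h))%E.
Proof.
move=> apx line infE; apply/lee_addgt0Pr => e e0.
(* Half of the error is for the infimum, half for the Borel replacement; the line multiplies both by
   [k]. *)
have e1 : 0 < e / (2 * k) by rewrite divr_gt0// mulr_gt0.
have [] := @lb_ereal_inf_adherent _ (values h1) _ e1; first by rewrite infE.
move=> _ [g Gg <-]; rewrite infE -EFinD => Vg.
have e2 : 0 < e / (2 * k) / I by rewrite divr_gt0.
have [g' [Gg' mg']] := apx g _ Gg e2; rewrite divfK ?gt_eqF// => Vg'.
apply: (@le_trans _ _ (V h g' + e%:E)%E); last first.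
  by rewrite leeD2r//; apply: ereal_sup_ubound; exists g'.
have := decreasing_line_V Gg' mg' line; move: Vg Vg'.
have := V_G_ge0 hp1 Gg; have := V_G_ge0 hp1 Gg'; have := V_G_ge0 hp Gg'.
case: (V h g') => [w| |]// _; last by move=> *; rewrite leey.
case: (V h1 g) => [r| |]//; case: (V h1 g') => [r'| |]//.
rewrite -!EFinM -!EFinD !lee_fin lte_fin => _ _ rs r's hh.
have : k * r' <= k * (s0 * I + e / (2 * k) + e / (2 * k)).
  by rewrite ler_pM2l//; lra.
have -> : k * (s0 * I + e / (2 * k) + e / (2 * k)) = k * (s0 * I) + e.
  by field; rewrite gt_eqF.
lra.
Qed.

End orlicz_extremum.

(** * The six cases, for either class of test functions *)

Section comparison.
Variables (R : realType) (n : nat) (F1 F2 : R -> R) (psi : 'rV[R]_n -> \bar R).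
Hypotheses (mF1 : measurable_fun setT F1) (mF2 : measurable_fun setT F2).
Hypotheses (F1_gt0 : forall t, 0 < F1 t) (F2_gt0 : forall t, 0 < F2 t).
Hypothesis psiC : in_C psi.
Hypothesis IF1 : (0 < IF psi F1 < +oo)%E.
Hypothesis IF2 : (0 < IF (legendre psi) F2 < +oo)%E.
Variables h h1 h1inv H : R -> R.
Hypothesis h1K : forall t, 0 < t -> h1inv (h1 t) = t.
Hypothesis HE : forall s, H s = h (h1inv s).

Local Notation psis := (legendre psi).
Local Notation I := (fine (IF psi F1)).
Local Notation J := [set h1 t | t in [set t : R | 0 < t]].
Local Notation g0 := (F2_comp F2 psis).

Variable G : set ('rV[R]_n -> R).
Hypothesis GF : G `<=` Fplus psis.
Hypothesis approx : forall j, pos_cont j -> (forall s t, 0 < s -> s < t -> j t < j s) ->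
  borel_approximable F1 F2 psi I G j.

Local Notation values k := (values F1 F2 psi G k).

(** [as_orlicz] and [G_orlicz] are the instances where [G] is [Fplus] or [Lset]. *)
Definition extremum (k : R -> R) : \bar R :=
  if `[< inPhi k >] then ereal_inf (values k) else ereal_sup (values k).

Lemma I_gt0 : 0 < I.
Proof. by rewrite fine_gt0. Qed.

Lemma IE : IF psi F1 = I%:E.
Proof. by have /andP[I0 Ioo] := IF1; rewrite fineK// ge0_fin_numE// ltW. Qed.

Lemma H_h1 t : 0 < t -> H (h1 t) = h t.
Proof. by move=> t0; rewrite HE h1K. Qed.

Lemma h1_inj s t : 0 < s -> 0 < t -> h1 s = h1 t -> s = t.
Proof. by move=> s_0 t_0 st; rewrite -(h1K s_0) st h1K. Qed.

Lemma h1_nonconst : ~ const_pos h1.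
Proof.
by move=> /(_ 1 2 ltr01 (ltr0Sn R 1)) /(h1_inj ltr01 (ltr0Sn R 1)); lra.
Qed.

Lemma h_nonconst : pos_cont h1 -> incr_on J H \/ decr_on J H -> ~ const_pos h.
Proof.
move=> hp1 mH ch; have [t1 [t2 [t10 t20 l1 l2]]] :=
  pos_cont_inj_both_sides hp1 h1_inj ltr01.
have J1 : J (h1 t1) by exists t1.
have J2 : J (h1 t2) by exists t2.
have := ch _ _ t10 t20; rewrite -!H_h1// => E.
by case: mH => /(_ _ _ J1 J2 (lt_trans l1 l2)); rewrite E ltxx.
Qed.

(** [extremum] tests membership in Phi first, so a function of Psi yields a supremum only once
    constants are ruled out. *)
Lemma inPsi_notPhi (k : R -> R) : inPsi k -> ~ const_pos k -> ~ inPhi k.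
Proof.
move=> [_ [//|[_ cc]]] nc [_ [//|cv]].
have h12 : (1 : R) != 2 by rewrite lt_eqF// ltr1n.
have := cc 1 2 2^-1 ltr01 (ltr0Sn R 1) h12; have := cv 1 2 2^-1 ltr01 (ltr0Sn R 1) h12.
have t01 : 0 < (2^-1 : R) < 1 by lra.
by move=> /(_ t01) a /(_ t01) b; lra.
Qed.

Lemma extremum_Phi k : inPhi k -> extremum k = ereal_inf (values k).
Proof. by move=> kP; rewrite /extremum asboolT. Qed.

Lemma extremum_Psi k : inPsi k -> ~ const_pos k -> extremum k = ereal_sup (values k).
Proof. by move=> kP nc; rewrite /extremum asboolF//; exact: inPsi_notPhi. Qed.

Lemma inPsi_incr (k : R -> R) : inPsi k -> ~ const_pos k -> 
  forall s t, 0 < s -> s < t -> k s < k t.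
Proof. by move=> [_ [//|[ik _]]] _ s t; exact: ik. Qed.

Lemma test_value : exists2 c, 0 < c & forall k, pos_cont k ->
  V F1 F2 psi k g0 = (k c * I)%:E.
Proof.
have [c c0 Vc] := V_test mF2 F1_gt0 F2_gt0 psiC IF2; exists c => // k kp.
by rewrite Vc// EFinM -IE.
Qed.

Lemma test_bounds : G g0 -> exists2 c, 0 < c &
  forall j, pos_cont j -> (ereal_inf (values j) <= (j c * I)%:E)%E /\
    ((j c * I)%:E <= ereal_sup (values j))%E.
Proof.
move=> Gg0; have [c c0 Vc] := test_value; exists c => // j jp; rewrite -Vc//.
by split; [apply: ereal_inf_lbound|apply: ereal_sup_ubound]; exists g0.
Qed.

(** Comparing [H] at [s] with a larger value of [h1] shows that the slope is positive. *)
Lemma concave_line s : pos_cont h1 -> concave_on J H -> incr_on J H -> J s ->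
  exists2 k, 0 < k & forall t, 0 < t -> h t <= H s + k * (h1 t - s).
Proof.
move=> hp1 cH iH Js; have [t t0 tE] := Js.
have [t1 [t2 [t10 t20 l1 l2]]] := pos_cont_inj_both_sides hp1 h1_inj t0.
have J1 : J (h1 t1) by exists t1.
have J2 : J (h1 t2) by exists t2.
have [|k kP] := concave_supporting_line cH J1 Js J2; first by rewrite -tE l1.
exists k => [|u u0]; last by rewrite -(H_h1 u0); apply: kP; exists u.
rewrite tE in l2; have := kP _ J2; have := iH _ _ Js J2 l2 => a b.
have : 0 < k * (h1 t2 - s) by lra.
by rewrite pmulr_lgt0// subr_gt0.
Qed.

Lemma convex_concaveN : convex_on J H -> concave_on J (fun x => - H x).
Proof. by move=> cH x y t Jx Jy t01; have := cH x y t Jx Jy t01; lra. Qed.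

Lemma convex_line_incr s : pos_cont h1 -> convex_on J H -> incr_on J H -> J s ->
  exists2 k, 0 < k & forall t, 0 < t -> H s + k * (h1 t - s) <= h t.
Proof.
move=> hp1 cH iH Js; have [t t0 tE] := Js.
have [t1 [t2 [t10 t20 l1 l2]]] := pos_cont_inj_both_sides hp1 h1_inj t0.
have J1 : J (h1 t1) by exists t1.
have J2 : J (h1 t2) by exists t2.
have [|k kP] := concave_supporting_line (convex_concaveN cH) J1 Js J2.
  by rewrite -tE l1.
exists (- k) => [|u u0]; last first.
  by rewrite -(H_h1 u0); have := kP (h1 u) (ex_intro2 _ _ u u0 erefl); lra.
rewrite tE in l1; have := kP _ J1; have := iH _ _ J1 Js l1 => a b.
have : 0 < - k * (s - h1 t1) by lra.
by rewrite pmulr_lgt0// subr_gt0.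
Qed.

(** Here [k] is the opposite of the slope of [H], which puts [h] and [h1] on the same side. *)
Lemma convex_line_decr s : pos_cont h1 -> convex_on J H -> decr_on J H -> J s ->
  exists2 k, 0 < k & forall t, 0 < t -> H s + k * s <= h t + k * h1 t.
Proof.
move=> hp1 cH iH Js; have [t t0 tE] := Js.
have [t1 [t2 [t10 t20 l1 l2]]] := pos_cont_inj_both_sides hp1 h1_inj t0.
have J1 : J (h1 t1) by exists t1.
have J2 : J (h1 t2) by exists t2.
have [|k kP] := concave_supporting_line (convex_concaveN cH) J1 Js J2.
  by rewrite -tE l1.
exists k => [|u u0]; last first.
  by rewrite -(H_h1 u0); have := kP (h1 u) (ex_intro2 _ _ u u0 erefl); lra.
rewrite tE in l2; have := kP _ J2; have := iH _ _ Js J2 l2 => a b.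
have : 0 < k * (h1 t2 - s) by lra.
by rewrite pmulr_lgt0// subr_gt0.
Qed.

Lemma extremum_upper :
  ([/\ inPhi h, inPsi h1 & incr_on J H] /\ G g0) \/
  ([/\ inPhi h, inPhi h1 & decr_on J H] /\ G g0) \/
  [/\ concave_on J H, incr_on J H &
      (inPhi h /\ inPhi h1) \/ (inPsi h /\ inPsi h1)] ->
  orlicz_ineq true extremum I J h h1 H.
Proof.
move=> cases fQ Js; set s := fine (extremum h1) / I in Js *.
have Q1 : extremum h1 = (s * I)%:E by rewrite /s divfK ?gt_eqF ?I_gt0// fineK.
have [t t0 tE] := Js.
rewrite lee_pdivrMr ?I_gt0// -EFinM.
have nc1 := h1_nonconst.
case: cases => [[[hP h1P iH] Gg0]|[[[hP h1P dH] Gg0]|[cH iH]]].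
- have [hp _] := hP; have [hp1 _] := h1P; have [c c0 cP] := test_bounds Gg0.
  (* The test function gives [h c], that is [H (h1 c)], as an upper bound, and the supremum for [h1]
     is at least [h1 c * I]. *)
  rewrite extremum_Phi// (le_trans (cP h hp).1)// lee_fin ler_pM2r ?I_gt0//.
  have := (cP h1 hp1).2; rewrite -extremum_Psi// Q1 lee_fin ler_pM2r ?I_gt0//.
  rewrite -(H_h1 c0) le_eqVlt => /predU1P[->//|lt]; apply/ltW/iH => //; by exists c.
- have [hp _] := hP; have [hp1 _] := h1P; have [c c0 cP] := test_bounds Gg0.
  rewrite extremum_Phi// (le_trans (cP h hp).1)// lee_fin ler_pM2r ?I_gt0//.
  have := (cP h1 hp1).1; rewrite -extremum_Phi// Q1 lee_fin ler_pM2r ?I_gt0//.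
  rewrite -(H_h1 c0) le_eqVlt => /predU1P[->//|lt]; apply/ltW/dH => //; by exists c.
move=> kinds.
have [hp hp1] : pos_cont h /\ pos_cont h1 by case: kinds => -[[? _] [? _]].
have nc : ~ const_pos h by apply: h_nonconst => //; left.
have s_gt0 : 0 < s by rewrite -tE; have [+ _] := hp1; apply.
have Hs_gt0 : 0 < H s by rewrite -tE H_h1//; have [+ _] := hp; apply.
have [k k0 line] := concave_line hp1 cH iH Js.
case: kinds => -[hk h1k].
- rewrite extremum_Phi// in Q1; rewrite extremum_Phi//.
  exact: (inf_concave_le mF1 F1_gt0 F2_gt0 psiC IE GF hp hp1 s_gt0 Hs_gt0 k0 line Q1).
- rewrite extremum_Psi// in Q1; rewrite extremum_Psi//.
  exact: (sup_concave_le mF1 F1_gt0 F2_gt0 psiC IE GF hp hp1 s_gt0 Hs_gt0 k0 line Q1).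
Qed.

Lemma extremum_lower :
  ([/\ inPsi h, inPhi h1 & incr_on J H] /\ G g0) \/
  [/\ convex_on J H, decr_on J H &
      (inPhi h /\ inPsi h1) \/ (inPsi h /\ inPhi h1)] \/
  [/\ convex_on J H, incr_on J H &
      (inPhi h /\ inPhi h1) \/ (inPsi h /\ inPsi h1)] ->
  orlicz_ineq false extremum I J h h1 H.
Proof.
move=> cases fQ Js; set s := fine (extremum h1) / I in Js *.
have Q1 : extremum h1 = (s * I)%:E by rewrite /s divfK ?gt_eqF ?I_gt0// fineK.
have [t t0 tE] := Js.
rewrite lee_pdivlMr ?I_gt0// -EFinM.
have nc1 := h1_nonconst.
case: cases => [[[hP h1P iH] Gg0]|cases].
  have [hp _] := hP; have [hp1 _] := h1P; have [c c0 cP] := test_bounds Gg0.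
  have nc : ~ const_pos h by apply: h_nonconst => //; left.
  rewrite extremum_Psi// (le_trans _ (cP h hp).2)// lee_fin ler_pM2r ?I_gt0//.
  have := (cP h1 hp1).1; rewrite -extremum_Phi// Q1 lee_fin ler_pM2r ?I_gt0//.
  rewrite -(H_h1 c0) le_eqVlt => /predU1P[->//|lt]; apply/ltW/iH => //; by exists c.
have [hp hp1] : pos_cont h /\ pos_cont h1.
  by case: cases => -[_ _ [] [[? _] [? _]]].
have s_gt0 : 0 < s by rewrite -tE; have [+ _] := hp1; apply.
have Hs_gt0 : 0 < H s by rewrite -tE H_h1//; have [+ _] := hp; apply.
have nc : ~ const_pos h.
  by apply: h_nonconst => //; case: cases => -[_ mH _]; [right|left].
case: cases => -[cH mH kinds].
  have [k k0 line] := convex_line_decr hp1 cH mH Js.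
  case: kinds => -[hk h1k].
  - rewrite extremum_Psi// in Q1; rewrite extremum_Phi//.
    have hdec u v : 0 < u -> u < v -> h v < h u.
      move=> u0 uv; have v0 := lt_trans u0 uv; rewrite -!H_h1//.
      by apply: mH; [exists u|exists v|exact: inPsi_incr].
    exact: (inf_decreasing_ge mF1 mF2 F1_gt0 F2_gt0 psiC IE I_gt0 GF hp hp1 s_gt0 Hs_gt0 k0
      (approx hp hdec) line Q1).
  - rewrite extremum_Phi// in Q1; rewrite extremum_Psi//.
    (* If [h1] increased from [u] to [v], the decreasing [H] would make [h] decrease, but [h] is
       increasing as a nonconstant member of Psi. *)
    have hdec u v : 0 < u -> u < v -> h1 v < h1 u.
      move=> u0 uv; have v0 := lt_trans u0 uv; rewrite ltNge; apply/negP.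
      rewrite le_eqVlt => /predU1P[/(h1_inj u0 v0) E|lt]; first by rewrite E ltxx in uv.
      have Ju : J (h1 u) by exists u.
      have Jv : J (h1 v) by exists v.
      have := mH _ _ Ju Jv lt; rewrite !H_h1//; apply/negP; rewrite -leNgt ltW//.
      exact: inPsi_incr.
    exact: (sup_decreasing_ge mF1 mF2 F1_gt0 F2_gt0 psiC IE I_gt0 GF hp hp1 s_gt0 Hs_gt0 k0
      (approx hp1 hdec) line Q1).
have [k k0 line] := convex_line_incr hp1 cH mH Js.
case: kinds => -[hk h1k].
- rewrite extremum_Phi// in Q1; rewrite extremum_Phi//.
  exact: (inf_convex_ge mF1 F1_gt0 F2_gt0 psiC IE GF hp hp1 s_gt0 Hs_gt0 k0 line Q1).
- rewrite extremum_Psi// in Q1; rewrite extremum_Psi//.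
  exact: (sup_convex_ge mF1 F1_gt0 F2_gt0 psiC IE GF hp hp1 s_gt0 Hs_gt0 k0 line Q1).
Qed.

End comparison.

Unset Implicit Arguments.

Theorem theorem2p4 (R : realType) (n : nat) (F1 F2 : R -> R)
    (psi : 'rV[R]_n -> \bar R) (h h1 h1inv H : R -> R) :
  measurable_fun setT F1 -> measurable_fun setT F2 ->
  (forall t, 0 < F1 t) -> (forall t, 0 < F2 t) ->
  in_C psi ->
  (0 < IF psi F1 < +oo)%E -> (0 < IF (legendre psi) F2 < +oo)%E ->
  (forall t, 0 < t -> h1inv (h1 t) = t) ->
  (forall s, H s = h (h1inv s)) ->
  let I := fine (IF psi F1) in
  let J := [set h1 t | t in [set t : R | 0 < t]] in
  let caseA := [/\ inPhi h, inPsi h1 & incr_on J H] in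
  let caseB := [/\ inPhi h, inPhi h1 & decr_on J H] in
  let caseC := [/\ concave_on J H, incr_on J H &
                   (inPhi h /\ inPhi h1) \/ (inPsi h /\ inPsi h1)] in
  let caseD := [/\ inPsi h, inPhi h1 & incr_on J H] in
  let caseE := [/\ convex_on J H, decr_on J H &
                   (inPhi h /\ inPsi h1) \/ (inPsi h /\ inPhi h1)] in
  let caseF := [/\ convex_on J H, incr_on J H &
                   (inPhi h /\ inPhi h1) \/ (inPsi h /\ inPsi h1)] in
  let LC := Lset (legendre psi) (F2_comp F2 (legendre psi)) in
  let asQ := fun k => as_orlicz k F1 F2 psi in
  let GQ := fun k => G_orlicz k F1 F2 psi in
  [/\ (caseA \/ caseB \/ caseC -> orlicz_ineq true asQ I J h h1 H),
      (caseD \/ caseE \/ caseF -> orlicz_ineq false asQ I J h h1 H),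
      ((caseA /\ LC) \/ (caseB /\ LC) \/ caseC -> orlicz_ineq true GQ I J h h1 H) &
      ((caseD /\ LC) \/ caseE \/ caseF -> orlicz_ineq false GQ I J h h1 H)].
Proof.
move=> mF1 mF2 F1_gt0 F2_gt0 psiC IF1 IF2 h1K HE I J cA cB cC cD cE cF LC asQ GQ.
have Fg0 := Fplus_F2_comp mF2 F2_gt0 psiC IF2.
have FF : Fplus (legendre psi) `<=` Fplus (legendre psi) by [].
have LF : Lset (legendre psi) `<=` Fplus (legendre psi) by move=> g [].
have apxF j : pos_cont j -> (forall s t, 0 < s -> s < t -> j t < j s) ->
    borel_approximable F1 F2 psi I (Fplus (legendre psi)) j.
  move=> jp _ g e gF e0; rewrite EFinM /I -IE//.
  exact: V_borel_approx.
have apxL j : pos_cont j -> (forall s t, 0 < s -> s < t -> j t < j s) ->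
    borel_approximable F1 F2 psi I (Lset (legendre psi)) j.
  move=> jp jdec g e gL e0.
  have [g' [g'L mg' le]] := V_log_concave_approx F1_gt0 F2_gt0 psiC jp jdec gL.
  exists g'; split => //; rewrite (le_trans le)// leeDl// lee_fin.
  by rewrite mulr_ge0 ?ltW// I_gt0.
have upF := extremum_upper mF1 mF2 F1_gt0 F2_gt0 psiC IF1 IF2 h1K HE FF.
have loF := extremum_lower mF1 mF2 F1_gt0 F2_gt0 psiC IF1 IF2 h1K HE FF apxF.
have upL := extremum_upper mF1 mF2 F1_gt0 F2_gt0 psiC IF1 IF2 h1K HE LF.
have loL := extremum_lower mF1 mF2 F1_gt0 F2_gt0 psiC IF1 IF2 h1K HE LF apxL.
split => //.
(* For [Fplus] the membership of the test function holds in every case, by [Fg0]. *)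
- by move=> cs; apply: upF; case: cs => [?|[?|?]]; [left|right; left|right; right].
- by move=> cs; apply: loF; case: cs => [?|?]; [left|right].
Qed.
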